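(* Let $R$ be a commutative ring with identity, $n\ge 0$ and $k\ge 1$. The algebra homomorphism $$\theta_n\colon A^R_n[k]\longrightarrow \mathrm{Hom}_R(C(-)^{\otimes n},T(-^{\wedge k}))$$ sending the generator $\{y_{i_1}|y_{i_2}|\cdots|y_{i_k}\}$ to the composite $$C(V)^{\otimes n}\xrightarrow{\ p_{i_1,\dots,i_k}\ }C(V)^{\otimes k}\xrightarrow{\ q\ }V^{\wedge k}\xrightarrow{\ E\ }T(V^{\wedge k})$$ is an isomorphism of algebras.
   Context: For a free $R$-module $V$, $C(V)=R\oplus V$ is the coalgebra in which $V$ is primitive, with counit $\epsilon$, and $C(V)^{\otimes n}$ has the tensor product coalgebra structure. The smash product of coaugmented $R$-modules is $C\wedge D=(C\otimes D)/(C\otimes_R R\oplus R\otimes_R D)$; here $V^{\wedge k}$ denotes the quotient $C(V)^{\wedge k}$ with units collapsed, which as an $R$-module is $V^{\otimes k}$. $T(V^{\wedge k})$ is the tensor algebra on the $R$-module $V^{\wedge k}=V^{\otimes k}$. $\mathrm{Hom}_R(C(-)^{\otimes n},T(-^{\wedge k}))$ is the set of families of $R$-linear maps $f_V\colon C(V)^{\otimes n}\to T(V^{\wedge k})$ natural with respect to all $R$-linear maps of free $R$-modules $V$; it is an $R$-algebra under the convolution product $f*g=\mu\circ(f\otimes g)\circ\psi$, with $\psi$ the comultiplication of the source and $\mu$ the multiplication of the target. $A_n^R[k]$ is the quotient of the tensor algebra over $R$ generated by the words $\{y_{i_1}|y_{i_2}|\cdots|y_{i_k}\}$, $1\le i_j\le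 n$, by the two-sided ideal generated by the monomials $$\{y_{i_1}|\cdots|y_{i_k}\}\{y_{i_{k+1}}|\cdots|y_{i_{2k}}\}\cdots\{y_{i_{(l-1)k+1}}|\cdots|y_{i_{lk}}\}\quad(l\ge1)$$ with $i_s=i_t$ for some $1\le s<t\le kl$. The map $p_{i_1,\dots,i_k}=(p_{i_1}\otimes\cdots\otimes p_{i_k})\circ\psi^{(k)}$, where $\psi^{(k)}$ is the iterated comultiplication of $C(V)^{\otimes n}$ into $k$ factors and $p_j(x_1\otimes\cdots\otimes x_n)=\epsilon(x_1)\cdots\epsilon(x_{j-1})x_j\epsilon(x_{j+1})\cdots\epsilon(x_n)$; $q$ is the projection $C(V)^{\otimes k}\to V^{\otimes k}=V^{\wedge k}$, and $E$ is the inclusion. *)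

(* Defs.v *)
From HB Require Import structures.
From mathcomp Require Import all_boot all_order all_algebra.
From mathcomp Require Import generic_quotient ring_quotient boolp.

Set Implicit Arguments.
Unset Strict Implicit.
Unset Printing Implicit Defensive.

Import GRing.Theory.
Local Open Scope ring_scope.
Local Open Scope quotient_scope.

(* [mklin] is locked to keep simplification from unfolding bundled maps. *)
HB.lock Definition mklin (R : pzRingType) (U V : lmodType R) (f : U -> V)
  (fl : linear f) : {linear U -> V} :=
  HB.pack f (GRing.isLinear.Build R U V *:%R f fl).

Lemma mklinE (R : pzRingType) (U V : lmodType R) (f : U -> V) (fl : linear f) x :
  mklin fl x = f x.
Proof. by rewrite mklin.unlock. Qed.

Section Linear.
Variables (R : pzRingType) (U V : lmodType R).

Lemma lin_ext (f g : {linear U -> V}) : f =1 g -> f = g.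
Proof.
move=> /funext; case: f => f [[a0] [a1]]; case: g => g [[b0] [b1]] /= fg.
case: g / fg b0 b1 => b0 b1.
by rewrite (Prop_irrelevance a0 b0) (Prop_irrelevance a1 b1).
Qed.

End Linear.

(* [V] is free if it has a basis, i.e. a subset [B] that spans [V] and is
   linearly independent; the rank is arbitrary. *)
Definition is_basis (R : pzRingType) (V : lmodType R) (B : V -> Prop) :=
  (forall v : V, exists (s : seq V) (c : V -> R),
      {in s, forall x, B x} /\ v = \sum_(x <- s) c x *: x) /\
  (forall (s : seq V) (c : V -> R), uniq s -> {in s, forall x, B x} ->
      \sum_(x <- s) c x *: x = 0 -> {in s, forall x, c x = 0}).

Record freeMod (R : pzRingType) := FreeMod {
  free_sort :> lmodType R;
  _ : exists B : free_sort -> Prop, is_basis B }.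

Section DirectSum.
Variables (R : pzRingType) (I : choiceType) (F : I -> lmodType R).

Record dsum := DSum {
  dsum_val :> forall i, F i;
  dsum_fin : exists s : seq I, forall i, i \notin s -> dsum_val i = 0 }.

HB.instance Definition _ := gen_eqMixin dsum.
HB.instance Definition _ := gen_choiceMixin dsum.

Lemma dsumP (a b : dsum) : (forall i, a i = b i) <-> a = b.
Proof.
split=> [|-> //]; case: a => a fa; case: b => b fb /= ab.
have {}ab : a = b by apply: functional_extensionality_dep.
by case: b / ab fb => fb; rewrite (Prop_irrelevance fa fb).
Qed.

Lemma dsum0_fin : exists s : seq I, forall i, i \notin s -> (0 : F i) = 0.
Proof. by exists [::]. Qed.
Definition dsum0 := DSum dsum0_fin.

Lemma dsumN_fin (a : dsum) :
  exists s : seq I, forall i, i \notin s -> - a i = 0.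
Proof.
by case: (dsum_fin a) => s sP; exists s => i /sP ->; rewrite oppr0.
Qed.
Definition dsumN a := DSum (dsumN_fin a).

Lemma dsumD_fin (a b : dsum) :
  exists s : seq I, forall i, i \notin s -> a i + b i = 0.
Proof.
case: (dsum_fin a) (dsum_fin b) => s sP [t tP]; exists (s ++ t) => i.
by rewrite mem_cat negb_or => /andP[/sP-> /tP->]; rewrite addr0.
Qed.
Definition dsumD a b := DSum (dsumD_fin a b).

Lemma dsumZ_fin c (a : dsum) :
  exists s : seq I, forall i, i \notin s -> c *: a i = 0.
Proof.
by case: (dsum_fin a) => s sP; exists s => i /sP ->; rewrite scaler0.
Qed.
Definition dsumZ c a := DSum (dsumZ_fin c a).

Fact dsumDA : associative dsumD.
Proof. by move=> a b c; apply/dsumP=> i /=; rewrite addrA. Qed.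
Fact dsumDC : commutative dsumD.
Proof. by move=> a b; apply/dsumP=> i /=; rewrite addrC. Qed.
Fact dsum0D : left_id dsum0 dsumD.
Proof. by move=> a; apply/dsumP=> i /=; rewrite add0r. Qed.
Fact dsumND : left_inverse dsum0 dsumN dsumD.
Proof. by move=> a; apply/dsumP=> i /=; rewrite addNr. Qed.
HB.instance Definition _ :=
  GRing.isZmodule.Build dsum dsumDA dsumDC dsum0D dsumND.

Fact dsumZA c d a : dsumZ c (dsumZ d a) = dsumZ (c * d) a.
Proof. by apply/dsumP=> i /=; rewrite scalerA. Qed.
Fact dsum1Z : left_id 1 dsumZ.
Proof. by move=> a; apply/dsumP=> i /=; rewrite scale1r. Qed.
Fact dsumZDr : right_distributive dsumZ +%R.
Proof. by move=> c a b; apply/dsumP=> i /=; rewrite scalerDr. Qed.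
Fact dsumZDl a : {morph dsumZ^~ a : c d / c + d}.
Proof. by move=> c d; apply/dsumP=> i /=; rewrite scalerDl. Qed.
HB.instance Definition _ :=
  GRing.Zmodule_isLmodule.Build R dsum dsumZA dsum1Z dsumZDr dsumZDl.

Lemma dsum0E i : (0 : dsum) i = 0. Proof. by []. Qed.
Lemma dsumDE (a b : dsum) i : (a + b) i = a i + b i. Proof. by []. Qed.
Lemma dsumZE c (a : dsum) i : (c *: a) i = c *: a i. Proof. by []. Qed.

Lemma dsum_sumE J (s : seq J) (a : J -> dsum) i :
  (\sum_(j <- s) a j) i = \sum_(j <- s) a j i.
Proof. by elim/big_rec2: _ => // j _ x _ <-. Qed.

Lemma din_fin i (x : F i) : exists s : seq I,
  forall j, j \notin s -> dfwith (fun j => 0 : F j) x j = 0.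
Proof.
exists [:: i] => j; rewrite inE eq_sym => ij.
by rewrite dfwith_out.
Qed.
Definition din_fun i (x : F i) : dsum := DSum (din_fin x).

Lemma din_linear i : linear (@din_fun i).
Proof.
move=> c x y; apply/dsumP => j; rewrite dsumDE dsumZE /=.
have [<-|ij] := eqVneq i j; first by rewrite !dfwith_in.
by rewrite !dfwith_out // scaler0 addr0.
Qed.
Definition din i : {linear F i -> dsum} := mklin (@din_linear i).

Lemma din_in i (x : F i) : din i x i = x.
Proof. by rewrite mklinE /= dfwith_in. Qed.
Lemma din_out i j (x : F i) : i != j -> din i x j = 0.
Proof. by move=> ij; rewrite mklinE /= dfwith_out. Qed.

Lemma dsum_sum (a : dsum) (s : seq I) : uniq s ->
  (forall i, i \notin s -> a i = 0) -> a = \sum_(i <- s) din i (a i).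
Proof.
move=> us sP; apply/dsumP => j; rewrite dsum_sumE.
case: (boolP (j \in s)) => js.
  rewrite (bigD1_seq j js us) din_in big1 => [|i ij]; last exact: din_out.
  by apply/esym/addr0.
rewrite sP // big1_seq // => i /andP[_ si]; apply: din_out.
by apply: contraNneq js => <-.
Qed.

Lemma dsum_ind (P : dsum -> Prop) : P 0 -> (forall a b, P a -> P b -> P (a + b)) ->
  (forall i (x : F i), P (din i x)) -> forall a, P a.
Proof.
move=> P0 PD Pi a; case: (dsum_fin a) => s sP.
rewrite (@dsum_sum a (undup s)) ?undup_uniq //; last first.
  by move=> i; rewrite mem_undup => /sP.
by elim/big_ind: _.
Qed.

Section Lift.
Variables (M : lmodType R) (phi : forall i, {linear F i -> M}).

Definition dlift_fun (a : dsum) : M :=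
  \sum_(i <- undup (projT1 (cid (dsum_fin a)))) phi i (a i).

Lemma dlift_funE (a : dsum) (s : seq I) : uniq s ->
  (forall i, i \notin s -> a i = 0) -> dlift_fun a = \sum_(i <- s) phi i (a i).
Proof.
rewrite /dlift_fun; case: cid => t /= tP us sP.
pose u := undup (s ++ t).
have H r : uniq r -> (forall i, i \notin r -> a i = 0) -> {subset r <= u} ->
    \sum_(i <- r) phi i (a i) = \sum_(i <- u) phi i (a i).
  move=> ur rP ru; rewrite [RHS](bigID (mem r)) /= [X in _ + X]big1 ?addr0.
    rewrite -[RHS]big_filter; apply: perm_big; apply: uniq_perm => //.
      by rewrite filter_uniq ?undup_uniq.
    move=> i; rewrite mem_filter /=; case: (boolP (i \in r)) => //= ir.
    by rewrite ru.
  by move=> i /rP ->; rewrite linear0.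
rewrite [LHS]H ?undup_uniq //; first rewrite [RHS]H //.
- by move=> i; rewrite mem_undup mem_cat => ->.
- by move=> i; rewrite mem_undup => /tP.
- by move=> i; rewrite !mem_undup mem_cat orbC => ->.
Qed.

Lemma dlift_linear : linear dlift_fun.
Proof.
move=> c a b; case: (dsum_fin a) (dsum_fin b) => s sP [t tP].
pose u := undup (s ++ t).
have uu : uniq u by apply: undup_uniq.
have ua i : i \notin u -> a i = 0.
  by rewrite mem_undup mem_cat negb_or => /andP[/sP].
have ub i : i \notin u -> b i = 0.
  by rewrite mem_undup mem_cat negb_or => /andP[_ /tP].
have uc i : i \notin u -> (c *: a + b) i = 0.
  by move=> iu; rewrite dsumDE dsumZE ua ?ub // scaler0 addr0.
rewrite (dlift_funE uu ua) (dlift_funE uu ub) (dlift_funE uu uc).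
rewrite scaler_sumr -big_split /=; apply: eq_bigr => i _.
by rewrite linearP.
Qed.
Definition dlift : {linear dsum -> M} := mklin dlift_linear.

Lemma dliftE i (x : F i) : dlift (din i x) = phi i x.
Proof.
rewrite mklinE (@dlift_funE _ [:: i]) // ?big_seq1 ?din_in // => j.
by rewrite inE eq_sym => /din_out.
Qed.

End Lift.

Lemma dsum_ext (M : lmodType R) (f g : {linear dsum -> M}) :
  (forall i (x : F i), f (din i x) = g (din i x)) -> f =1 g.
Proof.
move=> fg; apply: dsum_ind => [|a b|//]; first by rewrite !linear0.
by rewrite !linearD => -> ->.
Qed.

End DirectSum.
Arguments din {R I F} i.

Section DirectSumMap.
Variables (R : pzRingType) (I : choiceType) (F G : I -> lmodType R).
Variable phi : forall i, {linear F i -> G i}.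

Lemma dmap_fin (a : dsum F) :
  exists s : seq I, forall i, i \notin s -> phi i (a i) = 0.
Proof.
by case: (dsum_fin a) => s sP; exists s => i /sP ->; rewrite linear0.
Qed.
Lemma dmap_linear : linear (fun a => DSum (dmap_fin a)).
Proof.
by move=> c a b; apply/dsumP=> i; rewrite dsumDE dsumZE /= linearP.
Qed.
Definition dmap : {linear dsum F -> dsum G} := mklin dmap_linear.

Lemma dmapE (a : dsum F) i : dmap a i = phi i (a i).
Proof. by rewrite /dmap mklinE. Qed.

Lemma dmap_din i (x : F i) : dmap (din i x) = din i (phi i x).
Proof.
apply/dsumP => j; rewrite dmapE.
have [<-|ij] := eqVneq i j; first by rewrite !din_in.
by rewrite !din_out // linear0.
Qed.

End DirectSumMap.

Section FreeModule.
Variables (R : pzRingType) (X : choiceType).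

Definition fmod : lmodType R := dsum (fun _ : X => R^o).
Definition fgen (x : X) : fmod := @din R X (fun=> R^o) x 1.

Lemma fmod_ind (P : fmod -> Prop) : P 0 -> (forall a b, P a -> P b -> P (a + b)) ->
  (forall c x, P (c *: fgen x)) -> forall a, P a.
Proof.
move=> P0 PD Pi; apply: dsum_ind => // x c.
by have := Pi c x; rewrite -linearZ /= /GRing.scale /= mulr1.
Qed.

Variables (M : lmodType R) (phi : X -> M).
Lemma flift_subproof x : linear (fun r : R^o => (r : R) *: phi x).
Proof. by move=> c r r'; rewrite scalerDl scalerA. Qed.
Definition flift : {linear fmod -> M} :=
  dlift (fun x => mklin (flift_subproof x)).
Lemma fliftE x : flift (fgen x) = phi x.
Proof. by rewrite dliftE mklinE scale1r. Qed.
End FreeModule.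
Arguments fgen {R X} x.

Section LQuot.
Variables (R : pzRingType) (M : lmodType R) (P : M -> Prop).

Inductive span : M -> Prop :=
| span_gen x of P x : span x
| span0 : span 0
| spanD x y of span x & span y : span (x + y)
| spanZ c x of span x : span (c *: x).

Definition spanp : {pred M} := fun x => `[< span x >].

Fact spanp_zmod : zmod_closed spanp.
Proof.
split=> [|x y /asboolP sx /asboolP sy]; apply/asboolP; first exact: span0.
by rewrite -scaleN1r; apply: spanD => //; apply: spanZ.
Qed.
HB.instance Definition _ := GRing.isZmodClosed.Build M spanp spanp_zmod.

Definition lquot := Quotient.quot spanp.
HB.instance Definition _ := GRing.Zmodule.on lquot.

Definition lpi_fun (x : M) : lquot := \pi_lquot x.

Lemma lpi_eq x y : lpi_fun x = lpi_fun y <-> span (x - y).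
Proof.
split=> [/eqP|sxy].
  by rewrite /lpi_fun -Quotient.idealrBE => /asboolP.
by apply/eqP; rewrite /lpi_fun -Quotient.idealrBE; apply/asboolP.
Qed.

Lemma lpiK (x : lquot) : lpi_fun (repr x) = x. Proof. exact: reprK. Qed.

Lemma lpiD : {morph lpi_fun : x y / x + y}.
Proof. by move=> x y; rewrite /lpi_fun !piE. Qed.

Definition lquotZ c (x : lquot) : lquot := lpi_fun (c *: repr x).

Lemma lpiZ c x : lpi_fun (c *: x) = lquotZ c (lpi_fun x).
Proof.
apply/lpi_eq; rewrite -scalerBr; apply: spanZ.
by apply/lpi_eq; rewrite lpiK.
Qed.

Fact lquotZA c d x : lquotZ c (lquotZ d x) = lquotZ (c * d) x.
Proof. by rewrite -[x]lpiK -!lpiZ scalerA. Qed.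
Fact lquot1Z : left_id 1 lquotZ.
Proof. by move=> x; rewrite -[x]lpiK -!lpiZ scale1r. Qed.
Fact lquotZDr : right_distributive lquotZ +%R.
Proof.
by move=> c x y; rewrite -[x]lpiK -[y]lpiK -!(lpiD, lpiZ) scalerDr.
Qed.
Fact lquotZDl x : {morph lquotZ^~ x : c d / c + d}.
Proof. by move=> c d; rewrite -[x]lpiK -!(lpiD, lpiZ) scalerDl. Qed.
HB.instance Definition _ :=
  GRing.Zmodule_isLmodule.Build R lquot lquotZA lquot1Z lquotZDr lquotZDl.

Lemma lpi_linear : linear lpi_fun.
Proof. by move=> c x y; rewrite lpiD lpiZ. Qed.
Definition lpi : {linear M -> lquot} := mklin lpi_linear.

Lemma lpiP x y : lpi x = lpi y <-> span (x - y).
Proof. by rewrite !mklinE; apply: lpi_eq. Qed.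
Lemma lpi_repr (x : lquot) : lpi (repr x) = x.
Proof. by rewrite mklinE lpiK. Qed.

Section Lift.
Variables (N : lmodType R) (phi : {linear M -> N}).
Hypothesis phiP : forall x, P x -> phi x = 0.

Lemma span_ker x : span x -> phi x = 0.
Proof.
elim=> [y /phiP //||y z _ y0 _ z0|c y _ y0]; first exact: linear0.
  by rewrite linearD y0 z0 addr0.
by rewrite linearZ y0 /= scaler0.
Qed.

Lemma llift_pi x : phi (repr (lpi x)) = phi x.
Proof.
apply/eqP; rewrite -subr_eq0 -linearB; apply/eqP/span_ker.
by apply/lpiP; rewrite lpi_repr.
Qed.

Lemma llift_linear : linear (fun x : lquot => phi (repr x)).
Proof.
move=> c x y; rewrite -[x]lpi_repr -[y]lpi_repr -linearP !llift_pi.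
exact: linearP.
Qed.
Definition llift : {linear lquot -> N} := mklin llift_linear.

Lemma lliftE x : llift (lpi x) = phi x.
Proof. by rewrite mklinE llift_pi. Qed.
End Lift.

End LQuot.

Section Tensor.
Variable R : comPzRingType.

Definition bilin (M N P : lmodType R) (f : M -> N -> P) :=
  (forall y, linear (f^~ y)) /\ (forall x, linear (f x)).

Section Bilinear.
Variables (M N P : lmodType R) (f : M -> N -> P) (fb : bilin f).

Lemma bilin0l y : f 0 y = 0.
Proof. by rewrite -[LHS](mklinE (fb.1 y)) linear0. Qed.
Lemma bilin0r x : f x 0 = 0.
Proof. by rewrite -[LHS](mklinE (fb.2 x)) linear0. Qed.
Lemma bilinDl y : {morph f^~ y : x x' / x + x'}.
Proof. by move=> x x'; rewrite -!(mklinE (fb.1 y)) linearD. Qed.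
Lemma bilinDr x : {morph f x : y y' / y + y'}.
Proof. by move=> y y'; rewrite -!(mklinE (fb.2 x)) linearD. Qed.
Lemma bilinZl c x y : f (c *: x) y = c *: f x y.
Proof. by rewrite -!(mklinE (fb.1 y)) linearZ. Qed.
Lemma bilinZr c x y : f x (c *: y) = c *: f x y.
Proof. by rewrite -!(mklinE (fb.2 x)) linearZ. Qed.
End Bilinear.

Section Def.
Variables M N : lmodType R.

Inductive tens_rel : fmod R (M * N)%type -> Prop :=
| tens_rel_l c m m' n :
    tens_rel (fgen (c *: m + m', n) - (c *: fgen (m, n) + fgen (m', n)))
| tens_rel_r c m n n' :
    tens_rel (fgen (m, c *: n + n') - (c *: fgen (m, n) + fgen (m, n'))).

Definition tens : lmodType R := lquot tens_rel.
Definition tprod (m : M) (n : N) : tens := lpi tens_rel (fgen (m, n)).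

Lemma tprod_bilin : bilin tprod.
Proof.
split=> [n c m m'|m c n n']; rewrite /tprod -linearP; apply/lpiP; apply: span_gen.
  exact: tens_rel_l.
exact: tens_rel_r.
Qed.

Lemma tens_ind (P : tens -> Prop) : (forall a b, P a -> P b -> P (a + b)) ->
  (forall m n, P (tprod m n)) -> forall a, P a.
Proof.
move=> PD Pg a; rewrite -[a]lpi_repr.
elim/fmod_ind: (repr a) => [|x y Px Py|c [m n]].
- by have := Pg 0 0; rewrite (bilin0l tprod_bilin) linear0.
- by rewrite linearD; apply: PD.
- by have := Pg (c *: m) n; rewrite (bilinZl tprod_bilin) linearZ.
Qed.

Lemma tens_ext (P : lmodType R) (f g : {linear tens -> P}) :
  (forall m n, f (tprod m n) = g (tprod m n)) -> f =1 g.
Proof.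
move=> fg; apply: tens_ind => [a b|//].
by rewrite !linearD => -> ->.
Qed.

Section Lift.
Variables (P : lmodType R) (f : M -> N -> P) (fb : bilin f).

Lemma tlift_subproof x : tens_rel x -> flift (fun mn => f mn.1 mn.2) x = 0.
Proof.
case=> [c m m' n|c m n n']; rewrite linearB linearP !fliftE /=.
  by rewrite fb.1 subrr.
by rewrite fb.2 subrr.
Qed.
Definition tlift : {linear tens -> P} := llift tlift_subproof.

Lemma tliftE m n : tlift (tprod m n) = f m n.
Proof. by rewrite lliftE fliftE. Qed.
End Lift.

End Def.

Definition tprod_lin_l (M N : lmodType R) (n : N) :
  {linear M -> tens M N} := mklin ((tprod_bilin M N).1 n).
Definition tprod_lin_r (M N : lmodType R) (m : M) :
  {linear N -> tens M N} := mklin ((tprod_bilin M N).2 m).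

Lemma tprodPl (M N : lmodType R) c (m m' : M) (n : N) :
  tprod (c *: m + m') n = c *: tprod m n + tprod m' n.
Proof. exact: (tprod_bilin M N).1. Qed.
Lemma tprodPr (M N : lmodType R) c (m : M) (n n' : N) :
  tprod m (c *: n + n') = c *: tprod m n + tprod m n'.
Proof. exact: (tprod_bilin M N).2. Qed.
Lemma tprod0l (M N : lmodType R) (n : N) : tprod (0 : M) n = 0.
Proof. exact: bilin0l (tprod_bilin M N) n. Qed.
Lemma tprod0r (M N : lmodType R) (m : M) : tprod m (0 : N) = 0.
Proof. exact: bilin0r (tprod_bilin M N) m. Qed.

Section Map.
Variables (M N M' N' : lmodType R).
Variables (f : {linear M -> M'}) (g : {linear N -> N'}).

Lemma tmap_bilin : bilin (fun m n => tprod (f m) (g n)).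
Proof.
split=> [n|m] c x y; rewrite linearP; first exact: tprodPl.
exact: tprodPr.
Qed.
Definition tmap : {linear tens M N -> tens M' N'} := tlift tmap_bilin.

Lemma tmapE m n : tmap (tprod m n) = tprod (f m) (g n).
Proof. exact: tliftE. Qed.
End Map.

(* [(a (x) b) (x) (c (x) d) |-> (a (x) c) (x) (b (x) d)], see [texchE] *)
Section Exchange.
Variables A B C D : lmodType R.
Local Notation target := (tens (tens A C) (tens B D)).

Definition exch1 (a : A) (b : B) : {linear tens C D -> target} :=
  tmap (tprod_lin_r C a) (tprod_lin_r D b).

Lemma exch1E a b c d :
  exch1 a b (tprod c d) = tprod (tprod a c) (tprod b d).
Proof. by rewrite /exch1 tmapE !mklinE. Qed.

Lemma exch1_bilin (y : tens C D) : bilin (fun a b => exch1 a b y).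
Proof.
split=> [b r a a'|a r b b']; elim/tens_ind: y => [y z|c d].
- by rewrite !linearD /= => -> ->; rewrite addrACA.
- by rewrite !exch1E !tprodPl.
- by rewrite !linearD /= => -> ->; rewrite addrACA.
- by rewrite !exch1E tprodPl tprodPr.
Qed.

Lemma exch2_bilin : bilin (fun (x : tens A B) y => tlift (exch1_bilin y) x).
Proof.
split=> [y|x]; first exact: linearP.
move=> r y y'; elim/tens_ind: x => [x z|a b].
  by rewrite !linearD /= => -> ->; rewrite addrACA.
by rewrite !tliftE linearP.
Qed.
Definition texch : {linear tens (tens A B) (tens C D) -> target} :=
  tlift exch2_bilin.

Lemma texchE a b c d : texch (tprod (tprod a b) (tprod c d)) =
  tprod (tprod a c) (tprod b d).
Proof. by rewrite 2!tliftE exch1E. Qed.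
End Exchange.

(* The recursion ends at [R], so the first power is [M (x) R] rather than [M]. *)
Fixpoint tpow (k : nat) (M : lmodType R) : lmodType R :=
  if k is k'.+1 then tens M (tpow k' M) else R^o.

Fixpoint tpure (k : nat) (M : lmodType R) : ('I_k -> M) -> tpow k M :=
  match k with
  | 0 => fun=> 1 : R^o
  | k'.+1 => fun x => tprod (x ord0) (tpure (fun i => x (lift ord0 i)))
  end.

Fixpoint tpow_maps (k : nat) (M N : lmodType R) :
    ('I_k -> {linear M -> N}) -> {linear tpow k M -> tpow k N} :=
  match k with
  | 0 => fun=> idfun
  | k'.+1 => fun f => tmap (f ord0) (tpow_maps (fun i => f (lift ord0 i)))
  end.

Definition tpow_map k (M N : lmodType R) (f : {linear M -> N}) :=
  tpow_maps (fun _ : 'I_k => f).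

Lemma tpow_maps_pure k (M N : lmodType R) (f : 'I_k -> {linear M -> N}) x :
  tpow_maps f (tpure x) = tpure (fun i => f i (x i)).
Proof. by elim: k f x => //= k IH f x; rewrite tmapE IH. Qed.

End Tensor.
Arguments tlift {R M N P f} fb.

(* The tensor algebra of [W]. Its product is concatenation, see [din_tpure],
   and [tgen] is the inclusion of [W] in degree 1. The ring and module
   structures are not bundled as an [algType], which would require [1 != 0]
   and hence exclude the zero ring [R]; [talg_scalerAl] and [talg_scalerAr]
   make [talg] an [R]-algebra. *)

Section TensorAlgebra.
Variables (R : comPzRingType) (W : lmodType R).

Definition talg := dsum (fun m => tpow m W).
HB.instance Definition _ := GRing.Lmodule.on talg.

(* Left multiplication by a vector [w]: [x |-> w (x) x] in each degree *)
Definition tshift_val (w : W) (a : talg) (m : nat) : tpow m W :=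
  if m is m'.+1 then tprod w (a m') else 0.

Lemma tshift_fin w (a : talg) :
  exists s : seq nat, forall m, m \notin s -> tshift_val w a m = 0.
Proof.
case: (dsum_fin a) => s sP; exists (map succn s) => -[//|m] /= ms.
rewrite sP ?tprod0r //.
by rewrite mem_map in ms; last exact: succn_inj.
Qed.
Definition tshift w a : talg := DSum (tshift_fin w a).

Lemma tshift_bilin : bilin tshift.
Proof.
split=> [a c w w'|w c a a']; apply/dsumP => -[|m]; rewrite dsumDE dsumZE /=.
- by rewrite scaler0 addr0.
- exact: (tprod_bilin _ _).1.
- by rewrite scaler0 addr0.
- exact: (tprod_bilin _ _).2.
Qed.

Lemma tshift_din w m (x : tpow m W) :
  tshift w (din m x) = din m.+1 (tprod w x : tpow m.+1 W).
Proof.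
apply/dsumP => -[|j]; first by rewrite din_out.
have [<-|mj] := eqVneq m j; first by rewrite din_in; congr tprod; rewrite din_in.
by rewrite [RHS]din_out // -[RHS](tprod0r _ w); congr tprod; rewrite din_out.
Qed.

Lemma tact0_linear (b : talg) : linear (fun r : R^o => (r : R) *: b).
Proof. by move=> c r r'; rewrite scalerDl scalerA. Qed.

Lemma tactS_bilin (Y : lmodType R) (f : {linear Y -> talg}) :
  bilin (fun w y => tshift w (f y)).
Proof.
split=> [y|w c y y'] /=; first exact: tshift_bilin.1.
by rewrite linearP tshift_bilin.2.
Qed.

(* [tmul_hom m b x] is the product [x b] for [x] homogeneous of degree [m] *)
Fixpoint tmul_hom m (b : talg) : {linear tpow m W -> talg} :=
  match m with
  | 0 => mklin (tact0_linear b)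
  | m'.+1 => tlift (tactS_bilin (tmul_hom m' b))
  end.

Definition tmul (a b : talg) : talg := dlift (tmul_hom^~ b) a.
Definition tone : talg := din 0 (1 : R^o).

Lemma tmul_din0 (r : R) b : tmul (din 0 (r : R^o)) b = r *: b.
Proof. by rewrite /tmul dliftE mklinE. Qed.

Lemma tmulDl a a' b : tmul (a + a') b = tmul a b + tmul a' b.
Proof. exact: linearD. Qed.
Lemma tmulZl c a b : tmul (c *: a) b = c *: tmul a b.
Proof. exact: linearZ. Qed.

Lemma tmul_shift w a b : tmul (tshift w a) b = tshift w (tmul a b).
Proof.
elim/dsum_ind: a => [|a a' IH IH'|m x].
- rewrite (bilin0r tshift_bilin).
  by rewrite /tmul linear0 (bilin0r tshift_bilin).
- by rewrite (bilinDr tshift_bilin) !tmulDl (bilinDr tshift_bilin) IH IH'.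
- by rewrite tshift_din /tmul !dliftE [LHS]tliftE.
Qed.

Lemma talg_ind (P : talg -> Prop) : (forall a b, P a -> P b -> P (a + b)) ->
  (forall r, P (r *: tone)) -> (forall w a, P a -> P (tshift w a)) ->
  forall a, P a.
Proof.
move=> PD P1 PS.
have P0 : P 0 by have := P1 0; rewrite scale0r.
apply: dsum_ind => // m; elim: m => [|m IH] x.
  by have := P1 x; rewrite -linearZ /= /GRing.scale /= mulr1.
elim/tens_ind: x => [x y|w x]; first by rewrite linearD; apply: PD.
by rewrite -tshift_din; apply: PS.
Qed.

Lemma tone_scale r : r *: tone = din 0 (r : R^o).
Proof. by rewrite -linearZ /= /GRing.scale /= mulr1. Qed.

Lemma tmul_bilin : bilin tmul.
Proof.
split=> [b|a]; first exact: linearP.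
move=> c x y; elim/talg_ind: a => [a a' IH IH'|r|w a IH].
- by rewrite !tmulDl IH IH' scalerDr addrACA.
- by rewrite tone_scale !tmul_din0 scalerDr !scalerA mulrC.
- by rewrite !tmul_shift IH tshift_bilin.2.
Qed.

Fact tmulA : associative tmul.
Proof.
move=> a b c; elim/talg_ind: a => [a a' IH IH'|r|w a IH].
- by rewrite !tmulDl IH IH'.
- by rewrite tone_scale !tmul_din0 tmulZl.
- by rewrite !tmul_shift IH.
Qed.
Fact tmul1 : left_id tone tmul.
Proof. by move=> a; rewrite tmul_din0 scale1r. Qed.
Fact tmulr1 : right_id tone tmul.
Proof.
move=> a; elim/talg_ind: a => [a a' IH IH'|r|w a IH].
- by rewrite tmulDl IH IH'.
- by rewrite tmulZl tmul1.
- by rewrite tmul_shift IH.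
Qed.
Fact tmul_Dl : left_distributive tmul +%R.
Proof. by move=> a b c; rewrite tmulDl. Qed.
Fact tmul_Dr : right_distributive tmul +%R.
Proof. by move=> a b c; rewrite (bilinDr tmul_bilin). Qed.
HB.instance Definition _ :=
  GRing.Zmodule_isPzRing.Build talg tmulA tmul1 tmulr1 tmul_Dl tmul_Dr.

Lemma talg_scalerAl (c : R) (a b : talg) : c *: (a * b) = c *: a * b.
Proof. by rewrite [RHS](bilinZl tmul_bilin). Qed.
Lemma talg_scalerAr (c : R) (a b : talg) : c *: (a * b) = a * (c *: b).
Proof. by rewrite [RHS](bilinZr tmul_bilin). Qed.

Lemma tgen_linear :
  linear (fun w : W => din 1 (tprod w (1 : R^o) : tpow 1 W) : talg).
Proof.
by move=> c w w'; rewrite -linearP (tprod_bilin _ _).1.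
Qed.
Definition tgen : {linear W -> talg} := mklin tgen_linear.

Lemma tgenE w (a : talg) : tgen w * a = tshift w a.
Proof.
rewrite [tgen w](_ : _ = tshift w 1); last first.
  by rewrite mklinE -[RHS]/(tshift w tone) tshift_din.
by rewrite [LHS]tmul_shift tmul1.
Qed.

Lemma din_tpure m (x : 'I_m -> W) :
  din m (tpure x) = \prod_(i < m) tgen (x i) :> talg.
Proof.
elim: m x => [|m IH] x; first by rewrite big_ord0.
by rewrite big_ord_recl -IH tgenE tshift_din.
Qed.

End TensorAlgebra.
Arguments tgen {R W}.

Definition talg_map (R : comPzRingType) (W W' : lmodType R)
    (g : {linear W -> W'}) : {linear talg W -> talg W'} :=
  dmap (fun m => tpow_map m g).

Lemma talg_map_shift (R : comPzRingType) (W W' : lmodType R)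
    (g : {linear W -> W'}) w a :
  talg_map g (tshift w a) = tshift (g w) (talg_map g a).
Proof.
apply/dsumP => -[|m]; rewrite dmapE; first exact: linear0.
by rewrite [LHS]tmapE; congr tprod; rewrite dmapE.
Qed.

Lemma talg_map1 (R : comPzRingType) (W W' : lmodType R)
    (g : {linear W -> W'}) : talg_map g 1 = 1.
Proof. exact: dmap_din. Qed.

Lemma talg_mapM (R : comPzRingType) (W W' : lmodType R)
    (g : {linear W -> W'}) : {morph talg_map g : a b / a * b}.
Proof.
move=> a b; elim/talg_ind: a => [a a' IH IH'|r|w a IH].
- by rewrite mulrDl !linearD /= mulrDl IH IH'.
- rewrite -[tone W]/(1 : talg W) -talg_scalerAl !linearZ /= talg_map1.
  by rewrite -talg_scalerAl !mul1r.
- rewrite [in RHS]talg_map_shift -!tgenE -!mulrA tgenE talg_map_shift IH.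
  by rewrite tgenE.
Qed.

Lemma talg_map_tgen (R : comPzRingType) (W W' : lmodType R)
    (g : {linear W -> W'}) w : talg_map g (tgen w) = tgen (g w).
Proof.
by rewrite -[tgen w]mulr1 tgenE talg_map_shift talg_map1 -tgenE mulr1.
Qed.

Section RQuot.
Variables (A : pzRingType) (P : A -> Prop).

Inductive tsideal : A -> Prop :=
| tsideal_gen x of P x : tsideal x
| tsideal0 : tsideal 0
| tsidealB x y of tsideal x & tsideal y : tsideal (x - y)
| tsidealMl a x of tsideal x : tsideal (a * x)
| tsidealMr a x of tsideal x : tsideal (x * a).

Definition tsidealp : {pred A} := fun x => `[< tsideal x >].

Fact tsidealp_zmod : zmod_closed tsidealp.
Proof.
split=> [|x y /asboolP sx /asboolP sy]; apply/asboolP; first exact: tsideal0.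
exact: tsidealB.
Qed.
HB.instance Definition _ := GRing.isZmodClosed.Build A tsidealp tsidealp_zmod.

Definition rquot := Quotient.quot tsidealp.
HB.instance Definition _ := GRing.Zmodule.on rquot.

Definition rpi (x : A) : rquot := \pi_rquot x.

Lemma rpi_eq x y : rpi x = rpi y <-> tsideal (x - y).
Proof.
split=> [/eqP|sxy].
  by rewrite /rpi -Quotient.idealrBE => /asboolP.
by apply/eqP; rewrite /rpi -Quotient.idealrBE; apply/asboolP.
Qed.

Lemma rpiK (x : rquot) : rpi (repr x) = x. Proof. exact: reprK. Qed.

Lemma rpiD : {morph rpi : x y / x + y}.
Proof. by move=> x y; rewrite /rpi !piE. Qed.

Definition rquot1 : rquot := rpi 1.
Definition rquotM (x y : rquot) : rquot := rpi (repr x * repr y).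

Lemma rpiM x y : rpi (x * y) = rquotM (rpi x) (rpi y).
Proof.
apply/rpi_eq; set x' := repr _; set y' := repr _.
have -> : x * y - x' * y' = (x - x') * y - x' * (y' - y).
  by rewrite mulrBl mulrBr opprB addrA addrNK.
apply: tsidealB; [apply: tsidealMr|apply: tsidealMl]; apply/rpi_eq;
  by rewrite rpiK.
Qed.

Fact rquotMA : associative rquotM.
Proof.
by move=> x y z; rewrite -[x]rpiK -[y]rpiK -[z]rpiK -!rpiM mulrA.
Qed.
Fact rquot1M : left_id rquot1 rquotM.
Proof. by move=> x; rewrite -[x]rpiK -rpiM mul1r. Qed.
Fact rquotM1 : right_id rquot1 rquotM.
Proof. by move=> x; rewrite -[x]rpiK -rpiM mulr1. Qed.
Fact rquotMDl : left_distributive rquotM +%R.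
Proof.
move=> x y z; rewrite -[x]rpiK -[y]rpiK -[z]rpiK.
by rewrite -!(rpiD, rpiM) mulrDl.
Qed.
Fact rquotMDr : right_distributive rquotM +%R.
Proof.
move=> x y z; rewrite -[x]rpiK -[y]rpiK -[z]rpiK.
by rewrite -!(rpiD, rpiM) mulrDr.
Qed.
HB.instance Definition _ :=
  GRing.Zmodule_isPzRing.Build rquot rquotMA rquot1M rquotM1 rquotMDl rquotMDr.

End RQuot.

Section AlgebraA.
Variables (R : comPzRingType) (n k : nat).

(* The word [{y_(i_1)| ... |y_(i_k)}] is the tuple [(i_1, ..., i_k)]; indices
   run over ['I_n], i.e. from 0 to [n - 1] *)
Definition word := k.-tuple 'I_n.

Definition word_talg := talg (fmod R word).
Definition wgen (w : word) : word_talg := tgen (fgen w : fmod R word).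

(* A product of [l >= 1] words in which a letter is repeated *)
Definition repeated (a : word_talg) : Prop :=
  exists s : seq word, [/\ s != [::],
    ~~ uniq (flatten [seq tval w | w <- s]) & a = \prod_(w <- s) wgen w].

Definition algA := rquot repeated.
HB.instance Definition _ := GRing.PzRing.on algA.

Definition algA_gen (w : word) : algA := rpi repeated (wgen w).

Definition algAZ c (x : algA) : algA := rpi repeated (c *: repr x).

Lemma algA_piZ c x : rpi repeated (c *: x) = algAZ c (rpi repeated x).
Proof.
apply/rpi_eq; rewrite -scalerBr -[_ - _]mul1r talg_scalerAl.
by apply: tsidealMl; apply/rpi_eq; rewrite rpiK.
Qed.

Fact algAZA c d x : algAZ c (algAZ d x) = algAZ (c * d) x.
Proof. by rewrite -[x]rpiK -!algA_piZ scalerA. Qed.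
Fact algA1Z : left_id 1 algAZ.
Proof. by move=> x; rewrite -[x]rpiK -!algA_piZ scale1r. Qed.
Fact algAZDr : right_distributive algAZ +%R.
Proof.
by move=> c x y; rewrite -[x]rpiK -[y]rpiK -!(rpiD, algA_piZ) scalerDr.
Qed.
Fact algAZDl x : {morph algAZ^~ x : c d / c + d}.
Proof. by move=> c d; rewrite -[x]rpiK -!(rpiD, algA_piZ) scalerDl. Qed.
HB.instance Definition _ :=
  GRing.Zmodule_isLmodule.Build R algA algAZA algA1Z algAZDr algAZDl.

Lemma algA_scalerAl (c : R) (x y : algA) : c *: (x * y) = c *: x * y.
Proof.
rewrite -[LHS]/(algAZ c (rquotM x y)) -[RHS]/(rquotM (algAZ c x) y).
by rewrite -[x]rpiK -[y]rpiK -rpiM -!algA_piZ -rpiM talg_scalerAl.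
Qed.
Lemma algA_scalerAr (c : R) (x y : algA) : c *: (x * y) = x * (c *: y).
Proof.
rewrite -[LHS]/(algAZ c (rquotM x y)) -[RHS]/(rquotM x (algAZ c y)).
by rewrite -[x]rpiK -[y]rpiK -rpiM -!algA_piZ -rpiM talg_scalerAr.
Qed.

End AlgebraA.

Section Coalgebra.
Variable R : comPzRingType.

Definition Cmod (V : lmodType R) : lmodType R := (R^o * V)%type.

Section OneModule.
Variable V : lmodType R.

Definition Cone : Cmod V := (1 : R^o, 0).
Definition Cprim (v : V) : Cmod V := (0 : R^o, v).
Definition Ceps : {linear Cmod V -> R^o} := fst.
Definition Cproj : {linear Cmod V -> V} := snd.

Lemma Cpsi_linear : linear (fun x : Cmod V =>
  (x.1 : R) *: tprod Cone Cone + tprod (Cprim x.2) Cone + tprod Cone (Cprim x.2)).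
Proof.
move=> c x y /=.
have -> : Cprim (c *: x.2 + y.2) = c *: Cprim x.2 + Cprim y.2.
  by congr pair; rewrite /= scaler0 addr0.
rewrite tprodPl tprodPr scalerDl -scalerA !scalerDr.
by rewrite [X in X + _ = _]addrACA [LHS]addrACA.
Qed.
(* [psi(1) = 1 (x) 1] and [psi(v) = v (x) 1 + 1 (x) v] for [v] in [V] *)
Definition Cpsi : {linear Cmod V -> tens (Cmod V) (Cmod V)} :=
  mklin Cpsi_linear.

Definition Cpow n : lmodType R := tpow n (Cmod V).

Lemma eps_bilin (Y : lmodType R) (f : {linear Y -> R^o}) :
  bilin (fun (x : Cmod V) y => (Ceps x * f y : R) : R^o).
Proof.
split=> [y|x] c z t; rewrite linearP.
  by rewrite mulrDl -mulrA.
by rewrite mulrDr mulrCA.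
Qed.
Fixpoint eps n : {linear Cpow n -> R^o} :=
  match n with
  | 0 => idfun
  | n'.+1 => tlift (eps_bilin (eps n'))
  end.

(* The comultiplication of a tensor product [A (x) B] is
   [A (x) B -> (A (x) A) (x) (B (x) B) -> (A (x) B) (x) (A (x) B)]; on the
   ground ring it is [1 |-> 1 (x) 1]. *)
Fixpoint psi n : {linear Cpow n -> tens (Cpow n) (Cpow n)} :=
  match n with
  | 0 => tprod_lin_l R^o (1 : R^o)
  | n'.+1 => texch _ _ _ _ \o tmap Cpsi (psi n')
  end.

Fixpoint psi_iter n k : {linear Cpow n -> tpow k (Cpow n)} :=
  match k with
  | 0 => eps n
  | k'.+1 => tmap idfun (psi_iter n k') \o psi n
  end.

Lemma pcoord0_bilin (Y : lmodType R) (f : {linear Y -> R^o}) :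
  bilin (fun (x : Cmod V) y => (f y : R) *: x).
Proof.
split=> [y|x] c z t; first by rewrite scalerDr !scalerA mulrC.
by rewrite linearP scalerDl scalerA.
Qed.
Lemma pcoordS_bilin (Y : lmodType R) (f : {linear Y -> Cmod V}) :
  bilin (fun (x : Cmod V) y => (Ceps x : R) *: f y).
Proof.
split=> [y|x] c z t; rewrite linearP.
  by rewrite scalerDl scalerA.
by rewrite scalerDr !scalerA mulrC.
Qed.
(* [p_(j+1)], meaningful for [j < n]: see [pcoord_pure] *)
Fixpoint pcoord n (j : nat) : {linear Cpow n -> Cmod V} :=
  match n, j with
  | 0, _ => \0
  | n'.+1, 0 => tlift (pcoord0_bilin (eps n'))
  | n'.+1, j'.+1 => tlift (pcoordS_bilin (pcoord n' j'))
  end.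

Lemma eps_pure n (x : 'I_n -> Cmod V) :
  eps n (tpure x) = \prod_(i < n) (Ceps (x i) : R).
Proof.
elim: n x => [|n IH] x; first by rewrite big_ord0.
by rewrite big_ord_recl /= tliftE IH.
Qed.

Lemma pcoord_pure n (x : 'I_n -> Cmod V) (j : 'I_n) :
  pcoord n j (tpure x) = (\prod_(i < n | i != j) (Ceps (x i) : R)) *: x j.
Proof.
elim: n x j => [|n IH] x j; first by case: j.
case: (unliftP ord0 j) => [i ->|->]; rewrite big_mkcond big_ord_recl /=.
  by rewrite tliftE IH -big_mkcond /= scalerA.
rewrite tliftE eps_pure mul1r.
by congr (_ *: _).
Qed.

Variables n k : nat.

(* [p_(i_1, ..., i_k)] for [w = (i_1, ..., i_k)] *)
Definition pword (w : word n k) : {linear Cpow n -> tpow k (Cmod V)} :=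
  tpow_maps (fun s : 'I_k => pcoord n (tnth w s)) \o psi_iter n k.

(* The smash power [V^k] is the module [tpow k V]. *)
Definition qproj : {linear tpow k (Cmod V) -> tpow k V} := tpow_map k Cproj.

Definition theta_gen_fun (w : word n k) : {linear Cpow n -> talg (tpow k V)} :=
  tgen \o (qproj \o pword w).

Definition talg_mu : {linear tens (talg (tpow k V)) (talg (tpow k V)) ->
  talg (tpow k V)} := tlift (tmul_bilin (tpow k V)).

Definition talg_eta : {linear R^o -> talg (tpow k V)} :=
  mklin (tact0_linear (1 : talg (tpow k V))).
Lemma talg_etaE (r : R) : talg_eta (r : R^o) = r *: (1 : talg (tpow k V)).
Proof. exact: mklinE. Qed.

End OneModule.

Lemma Cmap_linear (V W : lmodType R) (g : {linear V -> W}) :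
  linear (fun x : Cmod V => (x.1, g x.2) : Cmod W).
Proof. by move=> c x y; congr pair; rewrite linearP. Qed.
Definition Cmap (V W : lmodType R) (g : {linear V -> W}) :
  {linear Cmod V -> Cmod W} := mklin (Cmap_linear g).

Definition Cpow_map n (V W : lmodType R) (g : {linear V -> W}) :
  {linear Cpow V n -> Cpow W n} := tpow_map n (Cmap g).

Lemma tmap_comp (A B A1 B1 A2 B2 : lmodType R)
    (f : {linear A -> A1}) (g : {linear B -> B1})
    (f' : {linear A1 -> A2}) (g' : {linear B1 -> B2}) x :
  tmap f' g' (tmap f g x) = tmap (f' \o f) (g' \o g) x.
Proof.
elim/tens_ind: x => [x y|a b]; first by rewrite !linearD => -> ->.
by rewrite !tmapE.
Qed.

Lemma eq_tmap (A B A1 B1 : lmodType R) (f f' : {linear A -> A1})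
    (g g' : {linear B -> B1}) : f =1 f' -> g =1 g' -> tmap f g =1 tmap f' g'.
Proof. by move=> ff gg; apply: tens_ext => a b; rewrite !tmapE ff gg. Qed.

Lemma tpow_maps_comp k (M M' N N' : lmodType R) (h : {linear M -> M'})
    (h' : {linear N -> N'}) (f : 'I_k -> {linear M -> N})
    (f' : 'I_k -> {linear M' -> N'}) :
  (forall i x, f' i (h x) = h' (f i x)) ->
  forall x, tpow_maps f' (tpow_map k h x) = tpow_map k h' (tpow_maps f x).
Proof.
rewrite /tpow_map; elim: k f f' => [//|k IH] f f' ff x.
rewrite [LHS]tmap_comp [RHS]tmap_comp; apply: eq_tmap => y /=; first exact: ff.
by apply: IH => i z; apply: ff.
Qed.

Lemma texch_nat (A B C D A' B' C' D' : lmodType R)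
    (a : {linear A -> A'}) (b : {linear B -> B'})
    (c : {linear C -> C'}) (d : {linear D -> D'}) x :
  texch _ _ _ _ (tmap (tmap a b) (tmap c d) x) =
  tmap (tmap a c) (tmap b d) (texch _ _ _ _ x).
Proof.
elim/tens_ind: x => [x y|x y]; first by rewrite !linearD => -> ->.
rewrite tmapE; elim/tens_ind: x => [x z|p q].
  by rewrite linearD !(bilinDl (tprod_bilin _ _)) !linearD => -> ->.
elim/tens_ind: y => [x z|r s].
  by rewrite linearD !(bilinDr (tprod_bilin _ _)) !linearD => -> ->.
by rewrite !tmapE !texchE !tmapE.
Qed.

Section Naturality.
Variables (V W : lmodType R) (g : {linear V -> W}).

Lemma Cpsi_nat x : Cpsi W (Cmap g x) = tmap (Cmap g) (Cmap g) (Cpsi V x).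
Proof.
have g1 : Cmap g (Cone V) = Cone W by rewrite mklinE /Cone /= linear0.
have gp v : Cmap g (Cprim v) = Cprim (g v) by rewrite mklinE.
by rewrite ![Cpsi _ _]mklinE !linearD linearZ /= !tmapE !g1 !gp !mklinE.
Qed.

Lemma eps_nat n x : eps W n (Cpow_map n g x) = eps V n x.
Proof.
rewrite /Cpow_map /tpow_map; elim: n x => [//|n IH] x.
elim/tens_ind: x => [x y|c x]; first by rewrite !linearD => -> ->.
by rewrite /= tmapE !tliftE IH /= mklinE.
Qed.

Lemma psi_nat n x :
  psi W n (Cpow_map n g x) = tmap (Cpow_map n g) (Cpow_map n g) (psi V n x).
Proof.
rewrite /Cpow_map /tpow_map; elim: n x => [|n IH] x.
  by rewrite /= [tprod_lin_l _ _ _]mklinE tmapE.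
rewrite /= -texch_nat; congr (texch _ _ _ _ _).
rewrite !tmap_comp; apply: eq_tmap => y; first exact: Cpsi_nat.
exact: IH.
Qed.

Lemma psi_iter_nat n k x :
  psi_iter W n k (Cpow_map n g x) = tpow_map k (Cpow_map n g) (psi_iter V n k x).
Proof.
elim: k x => [|k IH] x; first exact: eps_nat.
rewrite /= psi_nat /tpow_map /= !tmap_comp.
by apply: eq_tmap => y //=; apply: IH.
Qed.

Lemma pcoord_nat n j x : pcoord W n j (Cpow_map n g x) = Cmap g (pcoord V n j x).
Proof.
rewrite /Cpow_map /tpow_map; elim: n j x => [|n IH] j x.
  by rewrite /= linear0.
elim/tens_ind: x => [x y|c x]; first by rewrite !linearD => -> ->.
case: j => [|j] /=; rewrite tmapE !tliftE linearZ; congr (_ *: _).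
- exact: eps_nat.
- by rewrite mklinE.
- exact: IH.
Qed.

Lemma theta_gen_nat n k (w : word n k) x :
  talg_map (tpow_map k g) (theta_gen_fun V w x) =
  theta_gen_fun W w (Cpow_map n g x).
Proof.
rewrite /theta_gen_fun /pword /qproj /= psi_iter_nat.
rewrite (tpow_maps_comp (h' := Cmap g) (f := fun s => pcoord V n (tnth w s))).
  rewrite (tpow_maps_comp (h' := g) (f := fun=> Cproj V)).
    exact: talg_map_tgen.
  by move=> i y; rewrite /= mklinE.
by move=> i y; rewrite pcoord_nat.
Qed.

Lemma talg_mu_nat k x : talg_map (tpow_map k g) (talg_mu V k x) =
  talg_mu W k (tmap (talg_map (tpow_map k g)) (talg_map (tpow_map k g)) x).
Proof.
elim/tens_ind: x => [x y|a b]; first by rewrite !linearD => -> ->.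
by rewrite tmapE [in LHS]tliftE [in RHS]tliftE [LHS]talg_mapM.
Qed.

End Naturality.

End Coalgebra.

Section NatHom.
Variables (R : comPzRingType) (n k : nat).

(* Families indexed by the free modules, natural in all linear maps. They form
   a type in a larger universe than the modules, hence their operations are
   given as functions rather than as an instance of the algebraic hierarchy. *)
Record natHom := NatHom {
  natHom_val :> forall V : freeMod R, {linear Cpow V n -> talg (tpow k V)};
  natHomP : forall (V W : freeMod R) (g : {linear V -> W}) x,
    talg_map (tpow_map k g) (natHom_val V x) = natHom_val W (Cpow_map n g x) }.

Lemma natHom_ext (f g : natHom) : (forall V x, f V x = g V x) -> f = g.
Proof.
case: f => f fP; case: g => g gP /= fg.
have {}fg : f = g.
  apply: functional_extensionality_dep => V; apply: lin_ext => x.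
  exact: fg.
by case: g / fg gP => gP; rewrite (Prop_irrelevance fP gP).
Qed.

Program Definition natHomD (f g : natHom) : natHom :=
  @NatHom (fun V => f V \+ g V) _.
Next Obligation. by rewrite linearD /= !natHomP. Qed.

Program Definition natHomZ (c : R) (f : natHom) : natHom :=
  @NatHom (fun V => c \*: f V) _.
Next Obligation. by rewrite linearZ /= !natHomP. Qed.

(* The convolution product [mu o (f (x) g) o psi] and its unit [eta o eps] *)
Program Definition natHomM (f g : natHom) : natHom :=
  @NatHom (fun V => talg_mu V k \o (tmap (f V) (g V) \o psi V n)) _.
Next Obligation.
rewrite talg_mu_nat psi_nat !tmap_comp; congr (talg_mu _ _ _).
by apply: eq_tmap => y /=; rewrite natHomP.
Qed.

Program Definition natHom1 : natHom :=
  @NatHom (fun V => talg_eta V k \o eps V n) _.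
Next Obligation. by rewrite eps_nat !talg_etaE linearZ /= talg_map1. Qed.

Definition theta_gen (w : word n k) : natHom :=
  NatHom (fun V W g => theta_gen_nat g w).

End NatHom.

Definition is_alg_hom (R : comPzRingType) (n k : nat)
    (th : algA R n k -> natHom R n k) : Prop :=
  [/\ forall c x y, th (c *: x + y) = natHomD (natHomZ c (th x)) (th y),
      forall x y, th (x * y) = natHomM (th x) (th y) &
      th 1 = natHom1 R n k].

(* Main.v *)
Require Import Defs.
From HB Require Import structures.
From mathcomp Require Import all_boot all_order all_algebra.
From mathcomp Require Import boolp.

(** Both sides are free with the same basis, the sequences of words of length
    [k] without a repeated letter, and the homomorphism matches the bases.

    On the left, the ideal is spanned by the monomials with a repeated letter,
    so the other monomials span the quotient ([normal_form]).

    On the right, [C(V)^n] is generated by the tensors with a primitive element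
    [y_i] at each [i] in a subset [S] of the factors and [1] elsewhere
    ([subset_tensor_ext]). Such a tensor is the image of a generic one, with
    [y_i = e_i], in the free module [U] on [e_1, ..., e_n]; by naturality a
    family [f] is determined by its values on these finitely many generic
    tensors. The value at the generic tensor on [S] is a combination of products
    of words in the [e_i], and a word in which the letters of [S] do not each
    occur exactly once, or in which another letter occurs, has coefficient [0]:
    killing [e_i] excludes letters that are in only one of [S] and the word
    ([target_coef_support]), and additivity in [e_i] excludes repetitions
    ([target_coef_repeated]). So [f] is given by one scalar for each sequence of
    words without a repeated letter.

    It remains to see that the image of a monomial is the family with exactly one
    such scalar, equal to [1]. The image of a generator reads off the primitive
    parts of the factors named by its word, and takes counits of the others
    ([word_form_gen]). Convolution concatenates such readings, and gives zero if
    a letter is used twice ([word_form_conv]). Hence a monomial sends the tensor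
    on [S] to the product of its words in the [y_i] if its letters are distinct
    and form [S], and to [0] otherwise ([theta_mono_subset_tensor]). This shows
    at once that the relations are respected, that the map is injective, and
    that it is onto. *)

Set Implicit Arguments.
Unset Strict Implicit.
Unset Printing Implicit Defensive.

Import GRing.Theory.
Local Open Scope ring_scope.

(** * Pure tensors *)

Section PureTensors.
Variable R : comPzRingType.
Implicit Types M N : lmodType R.

Lemma tpure_zero n M (x : 'I_n -> M) i : x i = 0 -> tpure x = 0.
Proof.
elim: n x i => [|n IH] x i; first by case: i.
case: (unliftP ord0 i) => [j ->|->] xi /=; last by rewrite xi tprod0l.
by rewrite (IH _ j xi) tprod0r.
Qed.

Lemma eq_tpure n M (x x' : 'I_n -> M) : x =1 x' -> tpure x = tpure x'.
Proof. by move=> /funext ->. Qed.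

(** The tuple [x] with entry [i] replaced by [u]: multilinearity of [tpure] is
    stated through it. *)
Definition update n M (x : 'I_n -> M) i (u : M) j := if j == i then u else x j.

Lemma tpure_updateD n M (x : 'I_n -> M) i u v :
  tpure (update x i (u + v)) = tpure (update x i u) + tpure (update x i v).
Proof.
elim: n x i => [|n IH] x i; first by case: i.
case: (unliftP ord0 i) => [j ->|->] /=.
  have E w : tpure (fun l => update x (lift ord0 j) w (lift ord0 l)) =
             tpure (update (fun l => x (lift ord0 l)) j w).
    by apply: eq_tpure => l; rewrite /update (inj_eq lift_inj).
  by rewrite !E IH /update /= (bilinDr (tprod_bilin _ _)).
by rewrite /update /= (bilinDl (tprod_bilin _ _)).
Qed.

Lemma span_image M N (G : M -> Prop) (H : N -> Prop) (f : {linear M -> N}) :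
  (forall m, G m -> Defs.span H (f m)) -> forall m, Defs.span G m -> Defs.span H (f m).
Proof.
move=> GH m; elim=> [x /GH //||x y _ Hx _ Hy|c x _ Hx].
- by rewrite linear0; apply: span0.
- by rewrite linearD; apply: spanD.
- by rewrite linearZ; apply: spanZ.
Qed.

Lemma span_ext M N (G : M -> Prop) (f g : {linear M -> N}) :
  (forall m, Defs.span G m) -> (forall m, G m -> f m = g m) -> f =1 g.
Proof.
move=> GM fg m; elim: (GM m) => [x /fg //||x y _ Hx _ Hy|c x _ Hx].
- by rewrite !linear0.
- by rewrite !linearD Hx Hy.
- by rewrite !linearZ Hx.
Qed.

(** By multilinearity, generators of [M] suffice as entries. With [1] and the
    primitive elements as generators of [C(V)] this is what makes
    [subset_tensor_ext] work. *)
Lemma tpow_span n M (G : M -> Prop) : (forall m, Defs.span G m) -> forall a : tpow n M,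
  Defs.span (fun z => exists2 x : 'I_n -> M, (forall i, G (x i)) & z = tpure x) a.
Proof.
move=> GM; elim: n => [|n IH] a.
  rewrite -[a]mulr1 -[_ * 1]/((a : R) *: (1 : R^o)); apply: spanZ; apply: span_gen.
  by exists (fun=> 0) => // -[].
elim/tens_ind: a => [a b|m b]; first exact: spanD.
move: (IH b).
rewrite -[tprod m b](mklinE ((tprod_bilin M (tpow n M)).2 m)).
apply: span_image => {}b [x Gx ->]; rewrite mklinE; move: (GM m).
rewrite -[tprod m _](mklinE ((tprod_bilin M (tpow n M)).1 (tpure x))).
apply: span_image => {}m Gm; rewrite mklinE; apply: span_gen.
exists (fun i => if unlift ord0 i is Some j then x j else m).
  by move=> i; case: unliftP.
rewrite /= unlift_none; congr tprod; apply: eq_tpure => i.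
by rewrite liftK.
Qed.

Lemma tpow_ext n M N (f g : {linear tpow n M -> N}) :
  (forall x, f (tpure x) = g (tpure x)) -> f =1 g.
Proof.
move=> fg; apply: (span_ext (tpow_span (G := fun=> True) _)) => [m|_ [x _ ->] //].
exact: span_gen.
Qed.

End PureTensors.

(** * Coproduct of a pure tensor *)

Section Cut.
Variables (R : comPzRingType) (V : lmodType R).

Lemma cut1_linear (b : bool) : linear (fun x : Cmod V =>
  (if b then Cprim x.2 else x.1 *: Cone V) : Cmod V).
Proof.
case: b => c x y /=; last by rewrite scalerDl scalerA.
by congr pair => /=; rewrite scaler0 addr0.
Qed.
Definition cut1 b : {linear Cmod V -> Cmod V} := mklin (cut1_linear b).

(** On the factors in [B], [cut B] projects [C(V)] onto [V]; on the others it
    projects onto the unit summand. *)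
Definition cut n (B : pred 'I_n) : {linear Cpow V n -> Cpow V n} :=
  tpow_maps (fun i => cut1 (B i)).

(** Since [psi(x) = x (x) 1 + 1 (x) v], where [v] is the primitive part of [x],
    projecting the right factor onto one of its two summands leaves one term. *)
Lemma Cpsi_cut1 b (x : Cmod V) :
  tmap idfun (cut1 b) (Cpsi V x) =
  tprod (if b then Cone V else x) (if b then Cprim x.2 else Cone V).
Proof.
rewrite [Cpsi V x]mklinE !linearD linearZ /= !tmapE !mklinE /=.
have E0 : (0 : R^o) *: Cone V = 0 by rewrite scale0r.
case: b => /=.
  have -> : @Cprim R V 0 = 0 by [].
  by rewrite !tprod0r scaler0 !add0r.
rewrite E0 scale1r tprod0r addr0 -tprodPl; congr tprod.
rewrite [RHS]surjective_pairing; congr pair => /=.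
  by rewrite addr0 [_ *: _]mulr1.
by rewrite scaler0 add0r.
Qed.

Lemma texch_step (A B : lmodType R) (cA : {linear A -> A}) (cB : {linear B -> B})
    (x : tens A A) (y : tens B B) a1 a2 b1 b2 :
  tmap idfun cA x = tprod a1 a2 -> tmap idfun cB y = tprod b1 b2 ->
  tmap idfun (tmap cA cB) (texch _ _ _ _ (tprod x y)) =
  tprod (tprod a1 b1) (tprod a2 b2).
Proof.
move=> xE yE; have idE : tmap idfun idfun =1 (idfun : tens A B -> tens A B).
  by apply: tens_ext => a b; rewrite tmapE.
rewrite -(@eq_tmap R _ _ _ _ _ _ (tmap cA cB) (tmap cA cB) idE) //.
by rewrite -texch_nat tmapE xE yE texchE.
Qed.

(** The full coproduct of a pure tensor is a sum over the subsets of the set of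
    factors. A map that reads only the primitive parts at a set [B] of factors
    and the counits elsewhere sees a single term of that sum, and this lemma
    isolates it, so that sums over subsets never have to be written. *)
Lemma psi_cut n (B : pred 'I_n) (x : 'I_n -> Cmod V) :
  tmap idfun (cut B) (psi V n (tpure x)) =
  tprod (tpure (fun i => if B i then Cone V else x i))
        (tpure (fun i => if B i then Cprim (x i).2 else Cone V)).
Proof.
elim: n B x => [|n IH] B x; first by rewrite /= [tprod_lin_l _ _ _]mklinE tmapE.
have -> : psi V n.+1 (tpure x) =
    texch _ _ _ _ (tprod (Cpsi V (x ord0)) (psi V n (tpure (fun i => x (lift ord0 i))))).
  by congr (texch _ _ _ _ _); apply: tmapE.
by rewrite (texch_step (Cpsi_cut1 _ _) (IH _ _)).
Qed.

End Cut.

(** * Maps that read off a word *)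

Lemma tpow_map_maps (R : comPzRingType) (M N P : lmodType R) k
    (h : {linear N -> P}) (f : 'I_k -> {linear M -> N}) x :
  tpow_map k h (tpow_maps f x) = tpow_maps (fun i => h \o f i) x.
Proof.
apply: (tpow_ext (f := tpow_map k h \o tpow_maps f)) => {}x.
by rewrite /= /tpow_map !tpow_maps_pure.
Qed.

Section WordForm.
Variables (R : comPzRingType) (V : lmodType R) (n : nat).
Implicit Types (u v : seq 'I_n) (y : 'I_n -> V) (x : 'I_n -> Cmod V).

(** The maps that read off the word [u]: primitive parts at the letters of [u],
    counits at the other factors. In all uses [F] is multilinear in the letters
    of [u]; [wf_local] and [wf_zero] are the part of this that convolution
    needs. *)
Record word_form (Y : lmodType R) u (F : ('I_n -> V) -> Y)
    (f : {linear Cpow V n -> Y}) : Prop := WordForm {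
  wf_local : forall y y', {in u, y =1 y'} -> F y = F y';
  wf_zero : forall y i, i \in u -> y i = 0 -> F y = 0;
  wf_pure : forall x, f (tpure x) =
    if uniq u then (\prod_(i < n | i \notin u) ((x i).1 : R)) *: F (fun i => (x i).2)
    else 0 }.

Lemma word_form_eq (Y : lmodType R) u F (f g : {linear Cpow V n -> Y}) :
  word_form u F f -> word_form u F g -> f =1 g.
Proof. by move=> wf wg; apply: tpow_ext => x; rewrite (wf_pure wf) (wf_pure wg). Qed.

Lemma word_form_comp (Y Z : lmodType R) u (F : ('I_n -> V) -> Y) f
    (h : {linear Y -> Z}) (g : {linear Cpow V n -> Z}) :
  word_form u F f -> (forall z, g z = h (f z)) -> word_form u (fun y => h (F y)) g.
Proof.
case=> Fl F0 fE gE; split=> [y y' /Fl -> //|y i iu yi|x].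
  by rewrite (F0 _ i) // linear0.
by rewrite gE fE; case: ifP; rewrite (linearZ, linear0).
Qed.

Lemma word_form_cut (Y : lmodType R) u (F : ('I_n -> V) -> Y) f :
  word_form u F f -> forall z, f (cut V (mem u) z) = f z.
Proof.
move=> wf; apply: (tpow_ext (f := f \o cut V (mem u))) => x /=.
rewrite /cut tpow_maps_pure !(wf_pure wf); case: ifP => // _.
congr (_ *: _).
  by apply: eq_bigr => i /negbTE iu; rewrite mklinE /= iu /= [_ *: _]mulr1.
by apply: (wf_local wf) => i iu; rewrite mklinE /= iu.
Qed.

Lemma tmap_absorb (A B D E : lmodType R) (f : {linear A -> D}) (g : {linear B -> E})
    (h : {linear B -> B}) z :
  (forall b, g (h b) = g b) -> tmap f g z = tmap f g (tmap idfun h z).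
Proof. by move=> gh; rewrite tmap_comp; apply: eq_tmap => b /=; rewrite ?gh. Qed.

(** Convolution concatenates words. By [word_form_cut] the right factor may be
    cut along [v], so [psi_cut] leaves one term, in which the left factor has
    [1] at the letters of [v]. If [u] and [v] share a letter, then [F] meets the
    primitive part of [1], which is [0]: this is why words with a repeated
    letter act by zero. *)
Lemma word_form_conv (Y Z : lmodType R) u v F G
    (f : {linear Cpow V n -> Y}) (g : {linear Cpow V n -> Z}) :
  word_form u F f -> word_form v G g ->
  word_form (u ++ v) (fun y => tprod (F y) (G y)) (tmap f g \o psi V n).
Proof.
move=> wf wg; split=> [y y' yy|y i|x].
- congr tprod; [apply: (wf_local wf) | apply: (wf_local wg)] => i iu;
    by apply: yy; rewrite mem_cat iu ?orbT.
- rewrite mem_cat => /orP[iu|iv] yi; first by rewrite (wf_zero wf iu yi) tprod0l.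
  by rewrite (wf_zero wg iv yi) tprod0r.
rewrite /= (tmap_absorb _ _ (word_form_cut wg)) psi_cut tmapE.
rewrite (wf_pure wf) (wf_pure wg) cat_uniq.
case: (uniq u); last by rewrite tprod0l.
case: (uniq v) => /=; last by rewrite tprod0r andbF.
rewrite andbT [X in tprod _ (X *: _)]big1 ?scale1r; last first.
  by move=> i /= /negbTE ->.
rewrite (wf_local wg (y' := fun i => (x i).2)) => [|i iv]; last by rewrite /= iv.
case: hasP => [[i iv iu]|uv] /=.
  by rewrite (wf_zero wf iu) ?scaler0 ?tprod0l //= (_ : i \in v).
rewrite (wf_local wf (y' := fun i => (x i).2)) => [|i iu]; last first.
  by rewrite /=; case: ifP => // iv; case: uv; exists i.
rewrite (bilinZl (tprod_bilin _ _)); congr (_ *: _).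
rewrite big_mkcond [RHS]big_mkcond; apply: eq_bigr => i _ /=.
by rewrite mem_cat; case: (i \in u) => //=; case: (i \in v).
Qed.

Lemma word_form_pcoord j : word_form [:: j] (fun y => y j) (Cproj V \o pcoord V n j).
Proof.
split=> [y y' -> //|y i|x]; first by rewrite inE.
  by rewrite inE => /eqP ->.
rewrite /= pcoord_pure; congr (_ *: _).
by apply: eq_bigl => i; rewrite inE.
Qed.

Lemma word_form_eps : word_form [::] (fun=> 1 : R^o) (eps V n).
Proof.
split=> [//|y i|x]; first by rewrite in_nil.
by rewrite eps_pure [RHS]mulr1.
Qed.

(** The map [p_(w_1, ..., w_k)] followed by the projection to [V] in each factor is
    an iterated convolution of the coordinate maps [p_(w_s)]. *)
Lemma word_form_psi_iter k (w : 'I_k -> 'I_n) :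
  word_form [seq w s | s <- enum 'I_k] (fun y => tpure (fun s => y (w s)))
    (tpow_maps (fun s => Cproj V \o pcoord V n (w s)) \o psi_iter V n k).
Proof.
elim: k w => [|k IH] w.
  have [? ? E] := word_form_eps; split=> [//|y i|x]; rewrite enum_ord0 ?in_nil //.
  exact: E.
rewrite enum_ordSl /= -map_comp.
have [Fl F0 E] := word_form_conv (word_form_pcoord (w ord0)) (IH (fun s => w (lift ord0 s))).
split=> [||x]; [exact: Fl|exact: F0|].
rewrite -E /= [LHS]tmap_comp; exact: eq_tmap.
Qed.

Variable k : nat.
Implicit Types (w : word n k) (s : seq (word n k)).

Definition letters s : seq 'I_n := flatten [seq tval w | w <- s].

Definition word_value (y : 'I_n -> V) w : tpow k V := tpure (fun l => y (tnth w l)).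

Definition words_value (y : 'I_n -> V) s : talg (tpow k V) :=
  \prod_(w <- s) tgen (word_value y w).

Lemma map_tnth_word w : [seq tnth w l | l <- enum 'I_k] = w.
Proof. exact: map_tnth_enum. Qed.

Lemma word_form_gen w : word_form w (fun y => tgen (word_value y w)) (theta_gen_fun V w).
Proof.
have := word_form_psi_iter (tnth w); rewrite map_tnth_word => wf.
apply: (word_form_comp (h := tgen) wf) => x.
by rewrite [LHS]/= /qproj tpow_map_maps.
Qed.

End WordForm.

(** * Convolution products of generators *)

Section ThetaMono.
Variables (R : comPzRingType) (n k : nat).
Implicit Types (V : freeMod R) (s t : seq (word n k)).

(** The image of the monomial [s] under the homomorphism to be constructed. *)
Definition theta_mono s : natHom R n k :=
  foldr (fun w => natHomM (theta_gen R w)) (natHom1 R n k) s.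

Lemma word_form_natHomM V u v F G (f g : natHom R n k) :
  word_form u F (f V) -> word_form v G (g V) ->
  word_form (u ++ v) (fun y => F y * G y) (natHomM f g V).
Proof.
move=> wf wg.
have [Fl F0 E] := word_form_comp (h := talg_mu V k) (g := natHomM f g V)
  (word_form_conv wf wg) (fun z => erefl).
have E' y : talg_mu V k (tprod (F y) (G y)) = F y * G y by exact: tliftE.
split=> [y y' /Fl|y i /F0 H /H|x]; by rewrite -?E'.
Qed.

Lemma word_form_mono V s : word_form (letters s) (fun y => words_value y s) (theta_mono s V).
Proof.
elim: s => [|w s IH]; last first.
  have [Fl F0 E] := word_form_natHomM (word_form_gen V w : word_form _ _ (theta_gen R w V)) IH.
  by split=> [y y' /Fl|y i /F0 H /H|x]; rewrite /words_value ?big_cons //; exact: E.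
have [Fl F0 E] := word_form_comp (h := talg_eta V k) (g := theta_mono [::] V)
  (word_form_eps V n) (fun z => erefl).
split=> [y y' _|y i|x]; rewrite /words_value ?big_nil //.
by rewrite E talg_etaE scale1r.
Qed.

(** Associativity of the convolution becomes that of concatenation: both sides
    read off the same word. *)
Lemma theta_mono_cat s t : theta_mono (s ++ t) = natHomM (theta_mono s) (theta_mono t).
Proof.
apply: natHom_ext => V; apply: (word_form_eq (word_form_mono V _)).
have [Fl F0 E] := word_form_natHomM (word_form_mono V s) (word_form_mono V t).
have fE : letters (s ++ t) = letters s ++ letters t by rewrite /letters map_cat flatten_cat.
by split=> [y y'|y i|x]; rewrite fE /words_value !big_cat; [apply: Fl|apply: F0|apply: E].
Qed.

Lemma theta_mono_gen w : theta_mono [:: w] = theta_gen R w.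
Proof.
apply: natHom_ext => V; apply: (word_form_eq (word_form_mono V _)).
have [Fl F0 E] := word_form_gen V w.
by split=> [y y'|y i|x]; rewrite /letters /= cats0 /words_value !big_seq1;
  [apply: Fl|apply: F0|apply: E].
Qed.

Lemma theta_mono_repeated s V x : ~~ uniq (letters s) -> theta_mono s V x = 0.
Proof.
move=> /negbTE us; apply: (tpow_ext (f := theta_mono s V) (g := \0)) => y.
by rewrite (wf_pure (word_form_mono V s)) us.
Qed.

End ThetaMono.

(** * Reduction to subset tensors *)

Section SubsetTensor.
Variables (R : comPzRingType) (n : nat).

(** The summand of [C(V)^n] spanned by these tensors, for a given [S], is a
    copy of the [#|S|]-fold tensor power of [V]. *)
Definition subset_tensor (V : lmodType R) (y : 'I_n -> V) (S : {set 'I_n}) : Cpow V n :=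
  tpure (fun i => if i \in S then Cprim (y i) else Cone V).

Lemma subset_tensor_ext (V N : lmodType R) (f g : {linear Cpow V n -> N}) :
  (forall y S, f (subset_tensor y S) = g (subset_tensor y S)) -> f =1 g.
Proof.
move=> fg; pose G (x : Cmod V) := x = Cone V \/ x = Cprim x.2.
apply: (span_ext (tpow_span (G := G) _)) => [m|_ [x Gx ->]].
  have -> : m = (m.1 : R) *: Cone V + Cprim m.2.
    rewrite {1}[m]surjective_pairing; congr pair => /=.
      by rewrite addr0 [_ *: _]mulr1.
    by rewrite scaler0 add0r.
  apply: spanD; first apply: spanZ; apply: span_gen; [by left | by right].
have -> : tpure x = subset_tensor (fun i => (x i).2) [set i | `[< x i <> Cone V >]].
  apply: eq_tpure => i; rewrite inE; case: asboolP => [xi|/contrapT //].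
  by case: (Gx i).
exact: fg.
Qed.

Lemma subset_tensor_map (V W : lmodType R) (g : {linear V -> W}) y S :
  Cpow_map n g (subset_tensor y S) = subset_tensor (fun i => g (y i)) S.
Proof.
rewrite /Cpow_map /tpow_map tpow_maps_pure; apply: eq_tpure => i.
by case: ifP => _; rewrite mklinE //= linear0.
Qed.

Lemma subset_tensor0 (V : lmodType R) (y : 'I_n -> V) (S : {set 'I_n}) i :
  i \in S -> y i = 0 -> subset_tensor y S = 0.
Proof. by move=> iS yi; apply: (@tpure_zero _ _ _ _ i); rewrite iS yi. Qed.

Lemma subset_tensorD (V : lmodType R) (y z1 z2 : 'I_n -> V) (S : {set 'I_n}) i :
  i \in S -> y i = z1 i + z2 i -> (forall j, j != i -> z1 j = y j /\ z2 j = y j) ->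
  subset_tensor y S = subset_tensor z1 S + subset_tensor z2 S.
Proof.
move=> iS yi yz; pose x j : Cmod V := if j \in S then Cprim (y j) else Cone V.
have E z u : z i = u -> (forall j, j != i -> z j = y j) ->
    subset_tensor z S = tpure (update x i (Cprim u)).
  move=> zi zj; apply: eq_tpure => j; rewrite /update.
  by case: eqVneq => [->|/zj ->]; rewrite ?iS ?zi.
rewrite (E y _ yi) // (E z1 (z1 i)) => // [|j /yz[]//].
rewrite (E z2 (z2 i)) => // [|j /yz[]//]; rewrite -tpure_updateD.
by congr (tpure (update x i _)); congr pair; rewrite /= addr0.
Qed.

(** A factor outside the word enters through its counit, which is [0] on
    primitive elements, and a letter of the word outside [S] meets the primitive
    part of [1]. Hence the letters of [s] have to be exactly [S]. *)
Lemma theta_mono_subset_tensor k (V : freeMod R) (s : seq (word n k)) (y : 'I_n -> V) S :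
  theta_mono R s V (subset_tensor y S) =
  if uniq (letters s) && (S == [set i in letters s]) then words_value y s else 0.
Proof.
rewrite (wf_pure (word_form_mono V s)); case: ifP => //= us.
case: eqP => [->|/eqP SE].
  rewrite big1 ?scale1r => [|i iu]; last by rewrite inE (negbTE iu).
  by apply: (wf_local (word_form_mono V s)) => i iu /=; rewrite inE iu.
case: (boolP [exists i in letters s, i \notin S]) => [/existsP[i /andP[iu iS]]|].
  by rewrite (wf_zero (word_form_mono V s) iu) ?scaler0 //= (negbTE iS).
rewrite negb_exists => /forallP H.
have sub i : i \in letters s -> i \in S.
  by move=> iu; have := H i; rewrite iu /= negbK.
have [i iS iu] : exists2 i, i \in S & i \notin letters s.
  apply/exists_inP; apply: contraNT SE; rewrite negb_exists_in => /forall_inP SP.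
  apply/eqP/setP => i; rewrite inE; apply/idP/idP => [/SP|/sub //].
  by rewrite negbK.
by rewrite (bigD1 i iu) /= iS /= mul0r scale0r.
Qed.

End SubsetTensor.

(** * Coefficient functionals *)

Section Functionals.
Variable R : comPzRingType.
Implicit Types V W Y : lmodType R.

Lemma cov_mul_bilin W Y (f : {linear W -> R^o}) (g : {linear Y -> R^o}) :
  bilin (fun x y => (f x * g y : R) : R^o).
Proof.
split=> [y|x] c z t; rewrite linearP; first by rewrite mulrDl -mulrA.
by rewrite mulrDr mulrCA.
Qed.

(** The tensor product of [m] covectors, as a covector on the tensor power. *)
Fixpoint cov_prod m W : ('I_m -> {linear W -> R^o}) -> {linear tpow m W -> R^o} :=
  match m with
  | 0 => fun=> idfun
  | m'.+1 => fun f => tlift (cov_mul_bilin (f ord0) (cov_prod (fun i => f (lift ord0 i))))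
  end.

Lemma cov_prod_pure m W (f : 'I_m -> {linear W -> R^o}) x :
  cov_prod f (tpure x) = \prod_(i < m) (f i (x i) : R).
Proof.
elim: m f x => [|m IH] f x; first by rewrite big_ord0.
by rewrite big_ord_recl /= tliftE IH.
Qed.

Lemma eq_cov_prod m W (f g : 'I_m -> {linear W -> R^o}) :
  (forall i, f i =1 g i) -> cov_prod f =1 cov_prod g.
Proof.
move=> fg; apply: tpow_ext => x; rewrite !cov_prod_pure.
by apply: eq_bigr => i _; rewrite fg.
Qed.

Lemma cov_prod_map m V W (g : {linear V -> W}) (f : 'I_m -> {linear W -> R^o}) x :
  cov_prod f (tpow_map m g x) = cov_prod (fun i => f i \o g) x.
Proof.
apply: (tpow_ext (f := cov_prod f \o tpow_map m g)) => {}x.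
by rewrite /= /tpow_map tpow_maps_pure !cov_prod_pure.
Qed.

Lemma cov_prod_zero m W (f : 'I_m -> {linear W -> R^o}) i x :
  (forall w, f i w = 0) -> cov_prod f x = 0.
Proof.
move=> fi; apply: (tpow_ext (f := cov_prod f) (g := \0)) => {}x.
by rewrite cov_prod_pure (bigD1 i) //= fi mul0r.
Qed.

(** Contracting the first factor with the dual basis reduces the claim to the
    next lower power. *)
Lemma tpow_sep (L : finType) W (b : L -> W) (psi : L -> {linear W -> R^o}) :
  (forall w, w = \sum_l (psi l w : R) *: b l) ->
  forall m (z : tpow m W),
    (forall t : 'I_m -> L, cov_prod (fun i => psi (t i)) z = 0) -> z = 0.
Proof.
move=> bE; elim=> [|m IH] z z0; first exact: (z0 (fun i => False_rect _ (notF (ltn_ord i)))).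
have cb l : bilin (fun w (y : tpow m W) => (psi l w : R) *: y).
  split=> [y|w] c u v; first by rewrite linearP scalerDl scalerA.
  by rewrite scalerDr !scalerA mulrC.
have -> : z = \sum_l tprod (b l) (tlift (cb l) z).
  elim/tens_ind: z {z0} => [x y xE yE|w y].
    rewrite {1}xE {1}yE -big_split /=; apply: eq_bigr => l _.
    by rewrite linearD (bilinDr (tprod_bilin _ _)).
  rewrite {1}(bE w) -[LHS](mklinE ((tprod_bilin W (tpow m W)).1 y)) linear_sum.
  apply: eq_bigr => l _; rewrite linearZ mklinE tliftE.
  by rewrite (bilinZr (tprod_bilin _ _)).
rewrite big1 // => l _; rewrite [tlift _ _]IH ?tprod0r // => t.
rewrite -(z0 (fun i => if unlift ord0 i is Some j then t j else l)) /=.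
apply: (tens_ext (f := cov_prod _ \o tlift (cb l))) => w y /=.
rewrite !tliftE linearZ unlift_none; congr (_ * _).
by apply: eq_cov_prod => i; rewrite liftK.
Qed.

Lemma dsum_coord_linear (I : choiceType) (F : I -> lmodType R) i :
  linear (fun a : dsum F => a i).
Proof. by move=> c x y. Qed.
Definition dsum_coord (I : choiceType) (F : I -> lmodType R) i : {linear dsum F -> F i} :=
  mklin (@dsum_coord_linear I F i).

Lemma dsum_coordE (I : choiceType) (F : I -> lmodType R) i (a : dsum F) : dsum_coord F i a = a i.
Proof. exact: mklinE. Qed.

Section SeqCoef.
Variables (T : eqType) (W : lmodType R) (psi : T -> {linear W -> R^o}).

Lemma seq_coef_linear (s : seq T) :
  linear (fun a : talg W => cov_prod (fun j => psi (tnth (in_tuple s) j)) (a (size s))).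
Proof. by move=> c a b; rewrite dsumDE dsumZE linearP. Qed.
Definition seq_coef s : {linear talg W -> R^o} := mklin (seq_coef_linear s).

Lemma seq_coefE s a :
  seq_coef s a = cov_prod (fun j => psi (tnth (in_tuple s) j)) (a (size s)).
Proof. exact: mklinE. Qed.

Lemma seq_coef_cons x s w (a : talg W) :
  seq_coef (x :: s) (tgen w * a) = (psi x w : R) * seq_coef s a.
Proof.
rewrite tgenE !seq_coefE [LHS]tliftE; congr (_ * _).
by apply: eq_cov_prod => i z; rewrite !(tnth_nth x).
Qed.

Lemma seq_coef_nil w (a : talg W) : seq_coef [::] (tgen w * a) = 0.
Proof. by rewrite tgenE seq_coefE. Qed.

Lemma seq_coef1 s : seq_coef s 1 = (s == [::])%:R.
Proof.
rewrite seq_coefE -[1]/(din 0 (1 : R^o) : talg W).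
by case: s => [|x s]; rewrite ?din_in // din_out //= linear0.
Qed.

(** For dual families [psi] and [b], [seq_coef psi s] is the coefficient of the
    monomial [s] in the elements [b]. *)
Lemma seq_coef_prod (b : T -> W) : (forall x t, psi x (b t) = (x == t)%:R) ->
  forall s r, seq_coef s (\prod_(t <- r) tgen (b t)) = (s == r)%:R.
Proof.
move=> bE s r; elim: r s => [|t r IH] s; first by rewrite big_nil seq_coef1.
rewrite big_cons; case: s => [|x s]; first exact: seq_coef_nil.
by rewrite seq_coef_cons bE IH eqseq_cons -natrM mulnb.
Qed.

End SeqCoef.

Lemma talg_sep (L : finType) W (b : L -> W) (psi : L -> {linear W -> R^o}) :
  (forall w, w = \sum_l (psi l w : R) *: b l) ->
  forall a a' : talg W, (forall s, seq_coef psi s a = seq_coef psi s a') -> a = a'.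
Proof.
move=> bE a a' aa; apply/eqP; rewrite -subr_eq0; apply/eqP/dsumP => m.
apply: (tpow_sep bE) => t; pose s := [tuple t i | i < m].
rewrite (eq_cov_prod (g := fun i => psi (tnth s i))) => [|i w]; last by rewrite tnth_mktuple.
case: s => s sm; have E := eqP sm; subst m.
have := aa s; rewrite !seq_coefE => H.
have H0 : cov_prod (fun j => psi (tnth (in_tuple s) j)) ((a - a') (size s)) = 0.
  by rewrite dsumDE linearD H -linearD /= subrr linear0.
rewrite -H0; apply: eq_cov_prod => i w; congr (psi _ w).
by have x0 := tnth (in_tuple s) i; rewrite !(tnth_nth x0).
Qed.

Definition gen_cov (X : choiceType) (x : X) : {linear fmod R X -> R^o} :=
  dsum_coord (fun _ : X => R^o) x.

Lemma gen_covE (X : choiceType) (x y : X) : gen_cov x (fgen y) = (x == y)%:R.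
Proof.
rewrite /gen_cov dsum_coordE /fgen; case: eqVneq => [->|xy]; first by rewrite din_in.
by rewrite din_out // eq_sym.
Qed.

Lemma fmod_expand (X : finType) (v : fmod R X) : v = \sum_x (gen_cov x v : R) *: fgen x.
Proof.
apply/dsumP => x.
suff : gen_cov x v = gen_cov x (\sum_y (gen_cov y v : R) *: fgen y) by rewrite /gen_cov !dsum_coordE.
rewrite linear_sum (bigD1 x) //= big1 => [|y yx].
  by rewrite addr0 linearZ /= gen_covE eqxx [RHS]mulr1.
by rewrite linearZ /= gen_covE eq_sym (negbTE yx) scaler0.
Qed.

Lemma fmod_span (X : choiceType) (v : fmod R X) :
  Defs.span (fun z => exists x : X, z = fgen x) v.
Proof.
elim/fmod_ind: v => [|a b|c x]; [exact: span0 | exact: spanD |].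
by apply: spanZ; apply: span_gen; exists x.
Qed.

(** Over the zero ring the generators [fgen x] all coincide; therefore the
    coefficient of a basis vector [z] is given by a formula in [z], and not by
    recovering an index from it. *)
Lemma fmod_free (X : choiceType) : exists B : fmod R X -> Prop, is_basis B.
Proof.
exists (fun v => exists x, v = fgen x); split=> [v|s c us sB].
  have [t0 tP] := dsum_fin v; pose t := undup t0.
  exists (map fgen t), (fun z : fmod R X => \sum_(x <- t) (v x : R) * (gen_cov x z : R)); split.
    by move=> z /mapP[x _ ->]; exists x.
  have tP' x : x \notin t -> v x = 0 by rewrite mem_undup; apply: tP.
  rewrite big_map {1}(dsum_sum (undup_uniq t0) tP') !big_seq.
  apply: eq_bigr => x xt; rewrite (bigD1_seq x) ?undup_uniq //= big1 => [|y yx].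
    rewrite addr0 gen_covE eqxx mulr1.
    by rewrite -linearZ; congr (din x _); rewrite [RHS]mulr1.
  by rewrite gen_covE (negbTE yx) mulr0.
move=> s0 z zs; have [x zx] := sB z zs.
have : gen_cov x (\sum_(x <- s) c x *: x) = 0 by rewrite s0 linear0.
rewrite linear_sum (bigD1_seq z) //= big1_seq => [|w /andP[wz ws]].
  by rewrite addr0 linearZ /= zx gen_covE eqxx [_ *: _]mulr1.
have [y wy] := sB w ws; rewrite linearZ /= wy gen_covE.
have /negbTE -> : x != y by apply: contraNneq wz => xy; rewrite wy zx xy.
by rewrite scaler0.
Qed.

Definition free_on (X : choiceType) : freeMod R := FreeMod (fmod_free X).

End Functionals.

(** * Coefficients on words *)

Section WordCoef.
Variables (R : comPzRingType).
Implicit Types V W : lmodType R.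

(** Each position of a product of [m] words of length [k] gets a covector of its
    own. This lets a single occurrence of a letter be probed separately from
    the other occurrences, see [target_coef_repeated]. *)
Definition pos_coef V k m (phi : 'I_m -> 'I_k -> {linear V -> R^o})
    (a : talg (tpow k V)) : R^o := cov_prod (fun j => cov_prod (phi j)) (a m).

Lemma eq_pos_coef V k m (phi phi' : 'I_m -> 'I_k -> {linear V -> R^o}) :
  (forall j l, phi j l =1 phi' j l) -> pos_coef phi =1 pos_coef phi'.
Proof. by move=> pp a; apply: eq_cov_prod => j; apply: eq_cov_prod. Qed.

Lemma pos_coefD V k m (phi : 'I_m -> 'I_k -> {linear V -> R^o}) a b :
  pos_coef phi (a + b) = pos_coef phi a + pos_coef phi b.
Proof. by rewrite /pos_coef dsumDE linearD. Qed.

Lemma pos_coef_map V W k m (g : {linear V -> W}) (phi : 'I_m -> 'I_k -> {linear W -> R^o}) a :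
  pos_coef phi (talg_map (tpow_map k g) a) = pos_coef (fun j l => phi j l \o g) a.
Proof.
rewrite /pos_coef dmapE cov_prod_map.
by apply: eq_cov_prod => j x /=; rewrite cov_prod_map.
Qed.

Lemma pos_coef_zero V k m (phi : 'I_m -> 'I_k -> {linear V -> R^o}) j l a :
  (forall v, phi j l v = 0) -> pos_coef phi a = 0.
Proof.
move=> p0; apply: (cov_prod_zero (i := j)) => x.
exact: (cov_prod_zero (i := l)).
Qed.

Variables n k : nat.
Implicit Types (w : word n k) (s : seq (word n k)).

Definition word_cov w : {linear tpow k (fmod R 'I_n) -> R^o} :=
  cov_prod (fun l => gen_cov R (tnth w l)).

Lemma word_covE w w' : word_cov w (word_value fgen w') = (w == w')%:R.
Proof.
rewrite /word_cov /word_value cov_prod_pure; case: eqVneq => [->|].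
  by rewrite big1 // => l _; rewrite gen_covE eqxx.
case: (boolP [exists l, tnth w l != tnth w' l]) => [/existsP[l ll] _|].
  by rewrite (bigD1 l) //= gen_covE (negbTE ll) mul0r.
rewrite negb_exists => /forallP H /eqP[]; apply: eq_from_tnth => l.
by have := H l; rewrite negbK => /eqP.
Qed.

Lemma word_value_expand (x : tpow k (fmod R 'I_n)) :
  x = \sum_w (word_cov w x : R) *: word_value fgen w.
Proof.
apply/eqP; rewrite -subr_eq0; apply/eqP.
apply: (tpow_sep (@fmod_expand R 'I_n)) => t.
pose w : word n k := [tuple t i | i < k].
rewrite (eq_cov_prod (g := fun i => gen_cov R (tnth w i))) => [|i z]; last first.
  by rewrite tnth_mktuple.
rewrite -/(word_cov w) linearB linear_sum (bigD1 w) //= big1 => [|w' ww].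
  by rewrite linearZ /= word_covE eqxx addr0 [_ *: _]mulr1 subrr.
by rewrite linearZ /= word_covE eq_sym (negbTE ww) scaler0.
Qed.

Definition target_coef s : {linear talg (tpow k (fmod R 'I_n)) -> R^o} := seq_coef word_cov s.

Definition letter s (j : 'I_(size s)) (l : 'I_k) : 'I_n := tnth (tnth (in_tuple s) j) l.

Lemma target_coefE s a : target_coef s a = pos_coef (fun j l => gen_cov R (letter (s := s) j l)) a.
Proof. exact: seq_coefE. Qed.

Lemma target_coef_words_value s t : target_coef s (words_value fgen t) = (s == t)%:R.
Proof. exact: (seq_coef_prod word_covE). Qed.

Lemma target_coef_sep a a' : (forall s, target_coef s a = target_coef s a') -> a = a'.
Proof. exact: (talg_sep word_value_expand). Qed.

Lemma lettersE s :
  letters s = [seq letter j l | j <- enum 'I_(size s), l <- enum 'I_k].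
Proof.
have E : s = [seq tnth (in_tuple s) j | j <- enum 'I_(size s)] by rewrite map_tnth_enum.
rewrite /letters [X in map _ X]E -map_comp; congr flatten.
by apply: eq_map => j /=; rewrite map_tnth_word.
Qed.

Lemma mem_lettersP s i : reflect (exists j l, i = letter (s := s) j l) (i \in letters s).
Proof.
rewrite lettersE; apply: (iffP allpairsP) => [[[j l] /= [_ _ ->]]|[j [l ->]]].
  by exists j, l.
by exists (j, l); rewrite !mem_enum.
Qed.

Lemma repeated_letter s : ~~ uniq (letters s) -> exists j l j' l',
  (j, l) != (j', l') /\ letter (s := s) j l = letter j' l'.
Proof.
move=> /negP nu; apply: contrapT => H; apply: nu; rewrite lettersE.
apply: allpairs_uniq; rewrite ?enum_uniq // => -[j l] [j' l'] _ _ /= E.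
apply: contrapT => /eqP jl; apply: H; exists j, l, j', l'; split=> //.
Qed.

Lemma size_letters s : size (letters s) = (size s * k)%N.
Proof. by rewrite lettersE size_allpairs !size_enum_ord. Qed.

End WordCoef.

(** * The homomorphism *)

Section TensorMap.
Variable R : comPzRingType.

Lemma tmap_linl (A B A' B' : lmodType R) c (f f' g : {linear A -> A'})
    (h : {linear B -> B'}) z :
  (forall x, g x = c *: f x + f' x) -> tmap g h z = c *: tmap f h z + tmap f' h z.
Proof.
move=> gE; elim/tens_ind: z => [x y|x y]; last by rewrite !tmapE gE tprodPl.
by rewrite !linearD /= => -> ->; rewrite addrACA.
Qed.

Lemma tmap_linr (A B A' B' : lmodType R) c (f f' g : {linear B -> B'})
    (h : {linear A -> A'}) z :
  (forall x, g x = c *: f x + f' x) -> tmap h g z = c *: tmap h f z + tmap h f' z.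
Proof.
move=> gE; elim/tens_ind: z => [x y|x y]; last by rewrite !tmapE gE tprodPr.
by rewrite !linearD /= => -> ->; rewrite addrACA.
Qed.

Lemma tmap_zero (A B A' B' : lmodType R) (f : {linear A -> A'}) (g : {linear B -> B'}) z :
  (forall x, f x = 0) \/ (forall y, g y = 0) -> tmap f g z = 0.
Proof.
move=> fg; apply: (tens_ext (f := tmap f g) (g := \0)) => x y; rewrite tmapE.
by case: fg => ->; rewrite (tprod0l, tprod0r).
Qed.

End TensorMap.

Lemma tsidealD (A : pzRingType) (P : A -> Prop) x y :
  tsideal P x -> tsideal P y -> tsideal P (x + y).
Proof.
move=> Px Py; rewrite -[y]opprK -[- y]add0r; apply: tsidealB => //.
by apply: tsidealB => //; exact: tsideal0.
Qed.

Section Theta.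
Variables (R : comPzRingType) (n k : nat).
Hypothesis k_gt0 : (0 < k)%N.
Implicit Types (s t r : seq (word n k)) (a b : word_talg R n k).

(** The [s] without repeated letters. There are finitely many: as [k] is
    positive, such an [s] has at most [n] words. They will be a basis of both
    algebras. *)
Definition uniq_words : seq (seq (word n k)) :=
  undup (filter (fun s => uniq (letters s))
    (flatten [seq [seq tval u | u <- enum {:m.-tuple (word n k)}] | m <- iota 0 n.+1])).

Lemma mem_uniq_words s : (s \in uniq_words) = uniq (letters s).
Proof.
rewrite mem_undup mem_filter; case: (boolP (uniq (letters s))) => [us|//]; rewrite andTb.
have sn : (size s <= n)%N.
  have := uniq_leq_size us (fun i _ => mem_enum 'I_n i).
  rewrite size_enum_ord size_letters; apply: leq_trans.
  by rewrite -{1}[size s]muln1 leq_mul2l k_gt0 orbT.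
apply/flattenP; exists [seq tval u | u <- enum {:(size s).-tuple (word n k)}].
  by apply/mapP; exists (size s) => //; rewrite mem_iota.
by apply/mapP; exists (in_tuple s); rewrite ?mem_enum.
Qed.

Lemma sum_uniq_words (V : lmodType R) (F : seq (word n k) -> V) r :
  \sum_(s <- uniq_words) ((s == r)%:R : R) *: F s = if uniq (letters r) then F r else 0.
Proof.
case: ifPn => [|ur].
  rewrite -mem_uniq_words => ur; rewrite (bigD1_seq r) ?undup_uniq //= eqxx scale1r.
  by rewrite big1 ?addr0 // => s /negbTE ->; rewrite scale0r.
rewrite big1_seq // => s /= sr; rewrite (_ : s == r = false) ?scale0r //.
by apply: contraNF ur => /eqP <-; rewrite -mem_uniq_words.
Qed.

Definition mono s : word_talg R n k := \prod_(w <- s) wgen R w.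

Lemma mono_cat s t : mono (s ++ t) = mono s * mono t.
Proof. exact: big_cat. Qed.

Lemma mono_span a : Defs.span (fun x => exists s, x = mono s) a.
Proof.
elim/talg_ind: a => [a b|r|w a].
- exact: spanD.
- by apply: spanZ; apply: span_gen; exists [::]; rewrite /mono big_nil.
rewrite -(mklinE ((tshift_bilin (fmod R (word n k))).2 w)).
apply: span_image => {}a [s ->]; rewrite mklinE.
rewrite -(mklinE ((tshift_bilin (fmod R (word n k))).1 (mono s))).
apply: span_image (fmod_span w) => _ [x ->]; rewrite mklinE; apply: span_gen.
by exists (x :: s); rewrite /mono big_cons -tgenE.
Qed.

Definition mono_coef s : {linear word_talg R n k -> R^o} := seq_coef (@gen_cov R (word n k)) s.

Lemma mono_coef_mono s t : mono_coef s (mono t) = (s == t)%:R.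
Proof. exact: (seq_coef_prod (@gen_covE R (word n k))). Qed.

Lemma natHom_lincomb_linear (c : seq (word n k) -> R) (F : seq (word n k) -> natHom R n k)
  (V : freeMod R) : linear (fun x => \sum_(s <- uniq_words) c s *: F s V x).
Proof.
move=> d x y; rewrite scaler_sumr -big_split /=; apply: eq_bigr => s _.
by rewrite linearP scalerDr !scalerA mulrC.
Qed.

Lemma natHom_lincomb_nat (c : seq (word n k) -> R) (F : seq (word n k) -> natHom R n k)
    (V W : freeMod R) (g : {linear V -> W}) x :
  talg_map (tpow_map k g) (mklin (@natHom_lincomb_linear c F V) x) =
  mklin (@natHom_lincomb_linear c F W) (Cpow_map n g x).
Proof.
rewrite !(mklinE (@natHom_lincomb_linear _ _ _)) linear_sum; apply: eq_bigr => s _.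
by rewrite linearZ /= natHomP.
Qed.

(** Defined on coefficients. The words with a repeated letter can be left out of
    the sum because [theta_mono] vanishes on them, and what remains is finite. *)
Definition theta_talg a : natHom R n k :=
  NatHom (@natHom_lincomb_nat (fun s => mono_coef s a) (@theta_mono R n k)).

Lemma theta_talgE a (V : freeMod R) x :
  theta_talg a V x = \sum_(s <- uniq_words) (mono_coef s a : R) *: theta_mono R s V x.
Proof. exact: mklinE. Qed.

Lemma theta_talgP (V : freeMod R) x : linear (fun a => theta_talg a V x).
Proof.
move=> c a b; rewrite !theta_talgE scaler_sumr -big_split /=.
by apply: eq_bigr => s _; rewrite linearP scalerDl scalerA.
Qed.

Lemma theta_talg_mono s : theta_talg (mono s) = theta_mono R s.
Proof.
apply: natHom_ext => V x; rewrite theta_talgE.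
under eq_bigr do rewrite mono_coef_mono.
by rewrite sum_uniq_words; case: ifPn => // us; rewrite theta_mono_repeated.
Qed.

(** Both sides are bilinear, hence it is enough to compare them on monomials. *)
Lemma theta_talgM a b : theta_talg (a * b) = natHomM (theta_talg a) (theta_talg b).
Proof.
apply: natHom_ext => V x.
pose M a b := talg_mu V k (tmap (theta_talg a V) (theta_talg b V) (psi V n x)).
rewrite -[RHS]/(M a b).
have Ml b' : linear (M^~ b').
  move=> c a1 a2; rewrite /M -linearP; congr (talg_mu _ _ _).
  by apply: tmap_linl => z; rewrite (theta_talgP z).
have Mr a' : linear (M a').
  move=> c b1 b2; rewrite /M -linearP; congr (talg_mu _ _ _).
  by apply: tmap_linr => z; rewrite (theta_talgP z).
have Tl b' : linear (fun a => theta_talg (a * b') V x).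
  move=> c a1 a2; rewrite mulrDl -talg_scalerAl; exact: theta_talgP.
have Tr a' : linear (fun b => theta_talg (a' * b) V x).
  move=> c b1 b2; rewrite mulrDr -talg_scalerAr; exact: theta_talgP.
rewrite -(mklinE (Tl b)) -(mklinE (Ml b)).
apply: (span_ext mono_span) => _ [s ->]; rewrite (mklinE (Tl b)) (mklinE (Ml b)).
rewrite -(mklinE (Tr (mono s))) -(mklinE (Mr (mono s))).
apply: (span_ext mono_span) => _ [t ->]; rewrite (mklinE (Tr (mono s))) (mklinE (Mr (mono s))).
by rewrite -mono_cat /M !theta_talg_mono theta_mono_cat.
Qed.

Lemma theta_talg0 V x : theta_talg 0 V x = 0.
Proof. by rewrite -(mklinE (theta_talgP x)) linear0. Qed.

Lemma theta_ideal a : tsideal (@repeated R n k) a -> forall V x, theta_talg a V x = 0.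
Proof.
elim=> {a} [_ [s [_ us ->]] V x||a b _ Ha _ Hb V x|b a _ Ha V x|b a _ Ha V x].
- by rewrite -/(mono s) theta_talg_mono theta_mono_repeated.
- exact: theta_talg0.
- by rewrite -(mklinE (theta_talgP x)) linearB !(mklinE (theta_talgP x)) Ha Hb subrr.
- transitivity (natHomM (theta_talg b) (theta_talg a) V x); first by rewrite -theta_talgM.
  by rewrite /= (tmap_zero _ (or_intror (Ha V))) linear0.
- transitivity (natHomM (theta_talg a) (theta_talg b) V x); first by rewrite -theta_talgM.
  by rewrite /= (tmap_zero _ (or_introl (Ha V))) linear0.
Qed.

Definition theta (z : algA R n k) : natHom R n k := theta_talg (repr z).

Lemma theta_pi a : theta (rpi (@repeated R n k) a) = theta_talg a.
Proof.
apply: natHom_ext => V x; apply/eqP; rewrite -subr_eq0.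
rewrite -!(mklinE (theta_talgP x)) -linearB (mklinE (theta_talgP x)).
by apply/eqP/theta_ideal; apply/rpi_eq; rewrite rpiK.
Qed.

Lemma theta_alg_hom : is_alg_hom theta.
Proof.
split=> [c x y|x y|].
- rewrite -[x]rpiK -[y]rpiK -[c *: _]algA_piZ -rpiD !theta_pi.
  by apply: natHom_ext => V z; rewrite theta_talgP.
- by rewrite -[x]rpiK -[y]rpiK -[_ * _]rpiM !theta_pi theta_talgM.
- rewrite -[1]/(rpi (@repeated R n k) 1) theta_pi.
  by rewrite (_ : 1 = mono [::]) ?theta_talg_mono // /mono big_nil.
Qed.

Lemma theta_genE w : theta (algA_gen R w) = theta_gen R w.
Proof.
rewrite theta_pi -theta_mono_gen -theta_talg_mono; congr theta_talg.
by rewrite /mono big_seq1.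
Qed.

Lemma alg_hom_mono (th : algA R n k -> natHom R n k) : is_alg_hom th ->
  (forall w, th (algA_gen R w) = theta_gen R w) ->
  forall s, th (rpi (@repeated R n k) (mono s)) = theta_mono R s.
Proof.
case=> _ thM th1 thg; elim=> [|w s IH]; first by rewrite /mono big_nil.
by rewrite /mono big_cons rpiM -/(mono s) [LHS]thM thg IH.
Qed.

Lemma theta_unique (th : algA R n k -> natHom R n k) : is_alg_hom th ->
  (forall w, th (algA_gen R w) = theta_gen R w) -> theta = th.
Proof.
move=> hth thg; apply/funext => z; rewrite -[z]rpiK; set a := repr z.
apply: natHom_ext => V x.
have L th' : is_alg_hom th' -> linear (fun a => th' (rpi (@repeated R n k) a) V x).
  case=> thD _ _ c a1 a2; rewrite rpiD algA_piZ.
  by rewrite -[algAZ _ _]/(c *: (rpi (@repeated R n k) a1 : algA R n k)) thD.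
rewrite -(mklinE (L _ theta_alg_hom)) -(mklinE (L _ hth)).
apply: (span_ext mono_span) => _ [s ->]; rewrite (mklinE (L _ theta_alg_hom)) (mklinE (L _ hth)).
by rewrite !alg_hom_mono //; [exact: theta_alg_hom | exact: theta_genE].
Qed.

(** * Injectivity *)

(** A monomial with a repeated letter lies in the ideal, so only the finitely many
    monomials without one survive in the quotient. *)
Lemma normal_form a :
  tsideal (@repeated R n k) (a - \sum_(s <- uniq_words) (mono_coef s a : R) *: mono s).
Proof.
elim: (mono_span a) => [_ [t ->]||x y _ Hx _ Hy|c x _ Hx].
- under eq_bigr do rewrite mono_coef_mono.
  rewrite sum_uniq_words; case: ifPn => ut; first by rewrite subrr; apply: tsideal0.
  rewrite subr0; apply: tsideal_gen; exists t; split=> //.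
  by apply: contraNneq ut => ->.
- by rewrite big1 ?subr0 => [|s _]; rewrite ?linear0 ?scale0r //; exact: tsideal0.
- under eq_bigr do rewrite linearD scalerDl.
  by rewrite big_split /= opprD addrACA; apply: tsidealD.
- under eq_bigr do rewrite linearZ /= -scalerA.
  rewrite -scaler_sumr -scalerBr -[_ - _]mul1r talg_scalerAl.
  exact: tsidealMl.
Qed.

Local Notation U := (free_on R 'I_n).
Local Notation generic := (subset_tensor (fgen : 'I_n -> U)).

Lemma target_coef_theta s t (S : {set 'I_n}) :
  target_coef R s (theta_mono R t U (generic S)) =
  (uniq (letters t) && (S == [set i in letters t]) && (s == t))%:R.
Proof.
rewrite theta_mono_subset_tensor; case: ifP => _; last by rewrite linear0.
exact: target_coef_words_value.
Qed.

(** Evaluating at the generic tensor on the set of letters of [s] reads off the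
    coefficient of [s] in the normal form. *)
Lemma theta_inj : injective theta.
Proof.
move=> x y xy; rewrite -[x]rpiK -[y]rpiK; apply/rpi_eq; set a := _ - _.
have a0 V z : theta_talg a V z = 0.
  rewrite -(mklinE (theta_talgP z)) linearB !(mklinE (theta_talgP z)).
  by rewrite -[theta_talg (repr x)]/(theta x) xy subrr.
have := normal_form a; rewrite big_seq big1 ?subr0 // => s.
rewrite mem_uniq_words => us.
have := congr1 (target_coef R s) (a0 U (generic [set i in letters s])).
rewrite theta_talgE linear0 linear_sum (bigD1_seq s) ?mem_uniq_words ?undup_uniq //=.
rewrite linearZ target_coef_theta us !eqxx /= big1 => [|t ts].
  by rewrite addr0 [_ *: _]mulr1 => ->; rewrite scale0r.
by rewrite linearZ /= target_coef_theta (eq_sym s) (negbTE ts) andbF scaler0.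
Qed.

(** * Surjectivity *)

(** Naturality with respect to the endomorphism that kills the basis vector
    [e_i]. If [i] is in [S] but not in [s], the tensor goes to [0] while the
    coefficient functional is unchanged; if [i] is in [s] but not in [S], the
    tensor is unchanged while the functional becomes [0]. *)
Lemma target_coef_support (f : natHom R n k) s (S : {set 'I_n}) i :
  (i \in S) != (i \in letters s) ->
  target_coef R s (f U (generic S)) = 0.
Proof.
move=> iSs; pose g : {linear U -> U} :=
  flift (fun j => if j == i then 0 else fgen j : U).
have gE j : g (fgen j) = if j == i then 0 else fgen j by exact: fliftE.
have H : target_coef R s (f U (Cpow_map n g (generic S))) =
         pos_coef (fun j l => gen_cov R (letter (s := s) j l) \o g) (f U (generic S)).
  by rewrite -natHomP target_coefE pos_coef_map.
have covg j v : j != i -> gen_cov R j (g v) = gen_cov R j v.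
  move=> ji; apply: (span_ext (f := gen_cov R j \o g) (@fmod_span _ _)) => _ [x ->] /=.
  rewrite gE; case: eqVneq => // ->; rewrite linear0 gen_covE.
  by rewrite (negbTE ji).
have cov0 v : gen_cov R i (g v) = 0.
  apply: (span_ext (f := gen_cov R i \o g) (g := \0) (@fmod_span _ _)) => _ [x ->] /=.
  by rewrite gE; case: eqVneq => [_|xi]; rewrite ?linear0 // gen_covE eq_sym (negbTE xi).
move: H; rewrite subset_tensor_map; case: (boolP (i \in S)) iSs => iS /=.
  rewrite (subset_tensor0 iS) ?gE ?eqxx // linear0 linear0 => nis H.
  rewrite target_coefE H; apply: eq_pos_coef => j l v /=; rewrite covg //.
  by apply: contraNneq nis => <-; apply/mem_lettersP; exists j, l.
move=> /negPn/mem_lettersP [j [l ijl]].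
have -> : subset_tensor (fun j => g (fgen j)) S = generic S.
  apply: eq_tpure => x; case: ifP => // xS; rewrite gE.
  by case: eqVneq => // xi; rewrite -xi xS in iS.
by move=> ->; apply: (pos_coef_zero (j := j) (l := l)) => v /=; rewrite -ijl.
Qed.

(** Suppose the letter [i] occurs at two positions of [s]. Send [e_i] to
    [e_i + e'], with [e'] a new basis vector, and probe one of the two positions
    with the covector dual to [e'] and every other position as before: this
    gives the coefficient of [s]. The tensor is linear in its entry at [i], so
    the result is also the sum of the results for [e_i |-> e_i], where the
    position probed for [e'] sees none, and for [e_i |-> e'], where the other
    occurrence sees no [e_i]. Both are [0]. Unlike comparing the degrees in a
    scalar multiple of [e_i], this works over every ring. *)
Lemma target_coef_repeated (f : natHom R n k) s (S : {set 'I_n}) :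
  ~~ uniq (letters s) -> target_coef R s (f U (generic S)) = 0.
Proof.
move=> /repeated_letter [j [l [j' [l' [pq E]]]]]; set i := letter j l in E.
case: (boolP ((i \in S) == (i \in letters s))) => [|/target_coef_support //].
have -> : i \in letters s by apply/mem_lettersP; exists j, l.
move=> /eqP iS.
(* [None] indexes the new basis vector, probed at the position [(j, l)]. *)
pose U' := free_on R (option 'I_n).
pose h (v : U') : {linear U -> U'} := flift (fun x => if x == i then v else fgen (Some x) : U').
have hE v x : h v (fgen x) = if x == i then v else fgen (Some x) by exact: fliftE.
pose phi (x : 'I_(size s)) (y : 'I_k) : {linear U' -> R^o} :=
  gen_cov R (if (x, y) == (j, l) then None else Some (letter x y)).
pose K v := pos_coef phi (f U' (Cpow_map n (h v) (generic S))).
have KE v : K v = pos_coef (fun x y => phi x y \o h v) (f U (generic S)).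
  by rewrite /K -natHomP pos_coef_map.
have K1 : K (fgen None) = 0.
  rewrite KE; apply: (pos_coef_zero (j := j') (l := l')) => v.
  rewrite /phi eq_sym (negbTE pq) -E -/i.
  apply: (span_ext (f := gen_cov R (Some i) \o h _) (g := \0) (@fmod_span _ _)) => _ [x ->] /=.
  by rewrite hE; case: eqVneq => xi; rewrite gen_covE //= (inj_eq Some_inj) eq_sym (negbTE xi).
have K2 : K (fgen (Some i)) = 0.
  rewrite KE; apply: (pos_coef_zero (j := j) (l := l)) => v.
  rewrite /phi eqxx.
  apply: (span_ext (f := gen_cov R None \o h _) (g := \0) (@fmod_span _ _)) => _ [x ->] /=.
  by rewrite hE; case: ifP => _; rewrite gen_covE.
have -> : target_coef R s (f U (generic S)) = K (fgen (Some i) + fgen None).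
  rewrite target_coefE KE; apply: eq_pos_coef => x y v; rewrite /phi.
  apply: (span_ext (g := gen_cov R _ \o h _) (@fmod_span _ _)) => _ [z ->] /=.
  have SE (a b : 'I_n) : (Some a == Some b) = (a == b) by exact: (inj_eq Some_inj).
  rewrite hE; case: (eqVneq z i) => [->|zi]; rewrite ?linearD /= !gen_covE.
    by case: (eqVneq (x, y) (j, l)) => [[-> ->]|_]; rewrite ?SE ?eqxx /= ?add0r ?addr0.
  case: (eqVneq (x, y) (j, l)) => [[-> ->]|_]; last by rewrite SE.
  by rewrite eq_sym (negbTE zi).
rewrite /K !subset_tensor_map.
rewrite (subset_tensorD (i := i) (z1 := fun x => h (fgen (Some i)) (fgen x))
  (z2 := fun x => h (fgen None) (fgen x))) //.
- by rewrite linearD pos_coefD -!subset_tensor_map -/(K _) -/(K _) K1 K2 addr0.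
- by rewrite !hE eqxx.
- by move=> x /negbTE xi; rewrite !hE xi.
Qed.

(** The coefficients of the preimage are read off from the values of [f] at the
    generic tensors, which determine [f] by naturality. The two vanishing lemmas
    say that all other coefficients of these values are [0]. *)
Lemma theta_surj (f : natHom R n k) : exists z, theta z = f.
Proof.
pose c s := target_coef R s (f U (generic [set i in letters s])).
pose a := \sum_(s <- uniq_words) (c s : R) *: mono s.
exists (rpi (@repeated R n k) a); rewrite theta_pi; apply: natHom_ext => V.
apply: subset_tensor_ext => y S.
pose g : {linear U -> V} := flift y.
have -> : subset_tensor y S = Cpow_map n g (generic S).
  by rewrite subset_tensor_map; apply: eq_tpure => i; rewrite /g fliftE.
rewrite -!natHomP; congr (talg_map _ _); apply: target_coef_sep => s.
have -> : theta_talg a U (generic S) =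
    \sum_(t <- uniq_words) (c t : R) *: theta_mono R t U (generic S).
  rewrite -(mklinE (theta_talgP (V := U) _)) linear_sum; apply: eq_bigr => t _.
  by rewrite linearZ (mklinE (theta_talgP (V := U) _)) theta_talg_mono.
rewrite linear_sum.
rewrite (eq_bigr (fun t => ((t == s)%:R : R) *:
    ((uniq (letters s) && (S == [set i in letters s]))%:R * c s : R^o))) => [|t _]; last first.
  rewrite linearZ /= target_coef_theta (eq_sym s).
  case: (eqVneq t s) => [->|_]; first by rewrite andbT mulr1n scale1r [_ *: _]mulrC.
  by rewrite andbF mulr0n scaler0 scale0r.
rewrite sum_uniq_words; case: ifPn => us; last by rewrite target_coef_repeated.
rewrite us andTb; case: eqP => [->|/eqP SE]; first by rewrite mulr1n mul1r.
rewrite mul0r; apply/esym; have [i] : exists i, (i \in S) != (i \in letters s).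
  apply/existsP; apply: contraNT SE; rewrite negb_exists => /forallP H.
  by apply/eqP/setP => i; rewrite inE; apply/eqP; have := H i; rewrite negbK.
exact: target_coef_support.
Qed.

Lemma theta_bij : bijective theta.
Proof.
have H f := cid (theta_surj f).
exists (fun f => projT1 (H f)) => [z|f]; last by case: (H f).
by apply: theta_inj; case: (H _).
Qed.

End Theta.

Theorem proposition3p17 (R : comPzRingType) (n k : nat) (k_gt0 : (0 < k)%N) :
  exists theta : algA R n k -> natHom R n k,
    unique (fun th => is_alg_hom th /\
      forall w : word n k, th (algA_gen R w) = theta_gen R w) theta /\
    bijective theta.
Proof.
exists (@theta R n k); split; last exact: theta_bij.
split; first by split; [exact: theta_alg_hom | exact: theta_genE].
by move=> th [hth thg]; apply: theta_unique.
Qed.
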